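(* Let $\{Y_n\}$ be any stochastic process. Then, there exists a talent model $Y'_n=f(T,X_n)$ such that $\{Y'_n\}$ has the same joint distribution as $\{Y_n\}$ if and only if $\{Y_n\}$ is exchangeable.
   Context: Here $\{Y_n\}$ denotes a sequence $Y_1,Y_2,\ldots$ indexed by the positive integers. Talent model: a procedure that generates a sequence of observations, typically taking values in some subset of $\mathbb{R}$ (but not necessarily), whose $n$-th term is $f(T,X_n)$ for all $n\ge1$. Here $T$ (the ''talent'') is a random variable drawn from a fixed distribution, $\{X_n\}_{n\ge1}$ (the chance or ''luck'' components) is a sequence of i.i.d. random variables independent of $T$, and $f$ can be any measurable function; $f$ does not depend on $n$. Exchangeable: the sequence $Y_1,Y_2,\ldots$ is exchangeable if it is statistically indistinguishable from (has the same joint distribution as) $Y_{\sigma_1},Y_{\sigma_2},\ldots$ for any finite permutation $\sigma_1,\sigma_2,\ldots$ of the positive integers, where a permutation is finite if it leaves all indices fixed except a finite number of them. ''Same joint distribution'' refers to the distributions of the entire sequences, not only of their individual terms.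
   Formalization: The process is assumed to take values in a standard Borel space (isomorphic to a Borel subset of the real line, e.g. any real-valued process); for arbitrary measurable state spaces an exchangeable process need not come from a talent model (Dubins–Freedman). *)

(* Defs.v *)
From HB Require Import structures.
From mathcomp Require Import all_boot all_order all_algebra.
From mathcomp Require Import finmap.
From mathcomp Require Import all_classical all_reals all_analysis.

Set Implicit Arguments.
Unset Strict Implicit.
Unset Printing Implicit Defensive.

Import Order.TTheory GRing.Theory Num.Theory.
Import numFieldNormedType.Exports.

Local Open Scope classical_set_scope.
Local Open Scope ring_scope.

(* Sequences are indexed by nat: index n stands for the (n+1)-st term, so that
   the positive integers 1, 2, ... correspond to 0, 1, .... *)

(* Borel (standard Borel) space: isomorphic, as a measurable space, to a Borel
   subset of the real line.  With A := setT the last clause says that the range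
   of phi is Borel; for general A it says that the inverse of phi on its range
   is measurable. *)
Definition borel_space (R : realType) d (S : measurableType d) : Prop :=
  exists phi : S -> R,
    [/\ measurable_fun setT phi, injective phi &
        forall A : set S, measurable A -> measurable (phi @` A)].

Lemma borel_space_real (R : realType) : borel_space R (measurableTypeR R).
Proof.
exists id; split=> [|x y //|A mA]; first exact: measurable_id.
by rewrite image_id.
Qed.

(* The product sigma-algebra on S^nat. *)
Definition product_sigma_algebra d (S : measurableType d) :
    set (set (nat -> S)) :=
  <<s \bigcup_n preimage_set_system setT (fun y : nat -> S => y n) measurable >>.

Section probability_space.
Context d (Omega : measurableType d) (R : realType) (P : probability Omega R).

Definition joint_distribution d' (S : measurableType d')
    (Y : nat -> Omega -> S) (B : set (nat -> S)) : \bar R :=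
  P ((fun w n => Y n w) @^-1` B).

Definition mutually_independent d' (E : measurableType d')
    (X : nat -> {RV P >-> E}) : Prop :=
  forall (J : {fset nat}) (B : nat -> set E), (forall n, measurable (B n)) ->
    P (\bigcap_(n in [set` J]) X n @^-1` B n)
      = (\prod_(n <- J) P (X n @^-1` B n))%E.

Definition identically_distributed d' (E : measurableType d')
    (X : nat -> {RV P >-> E}) : Prop :=
  forall m n (B : set E), measurable B ->
    distribution P (X m) B = distribution P (X n) B.

(* T is independent of the sequence X as a whole, not merely of each term. *)
Definition independent_of_sequence d1 d2 (ET : measurableType d1)
    (EX : measurableType d2) (T : {RV P >-> ET}) (X : nat -> {RV P >-> EX}) :
    Prop :=
  forall (A : set ET) (B : set (nat -> EX)),
    measurable A -> product_sigma_algebra B ->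
    P (T @^-1` A `&` (fun w n => X n w) @^-1` B)
      = (P (T @^-1` A) * P ((fun w n => X n w) @^-1` B))%E.

End probability_space.

Definition same_joint_distribution (R : realType)
    d1 (Omega1 : measurableType d1) (P1 : probability Omega1 R)
    d2 (Omega2 : measurableType d2) (P2 : probability Omega2 R)
    d (S : measurableType d) (Y1 : nat -> Omega1 -> S)
    (Y2 : nat -> Omega2 -> S) : Prop :=
  forall B : set (nat -> S), product_sigma_algebra B ->
    joint_distribution P1 Y1 B = joint_distribution P2 Y2 B.

Definition finite_permutation (s : nat -> nat) : Prop :=
  bijective s /\ finite_set [set n | s n <> n].

Definition exchangeable (R : realType) d (Omega : measurableType d)
    (P : probability Omega R) d' (S : measurableType d')
    (Y : nat -> Omega -> S) : Prop :=
  forall s : nat -> nat, finite_permutation s ->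
    same_joint_distribution P P Y (fun n => Y (s n)).

(* The talent and the chance components may take values in arbitrary measurable
   spaces. *)
Record talent_model (R : realType) d (S : measurableType d) := TalentModel {
  tm_dOmega : measure_display ;
  tm_Omega : measurableType tm_dOmega ;
  tm_P : probability tm_Omega R ;
  tm_dT : measure_display ;
  tm_ET : measurableType tm_dT ;
  tm_dX : measure_display ;
  tm_EX : measurableType tm_dX ;
  tm_T : {RV tm_P >-> tm_ET} ;
  tm_X : nat -> {RV tm_P >-> tm_EX} ;
  tm_f : {mfun (tm_ET * tm_EX)%type >-> S} ;
  tm_X_independent : mutually_independent tm_X ;
  tm_X_identically_distributed : identically_distributed tm_X ;
  tm_T_independent : independent_of_sequence tm_T tm_X
}.

Definition tm_observation (R : realType) d (S : measurableType d)
    (M : talent_model R S) (n : nat) (w : tm_Omega M) : S :=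
  tm_f M (tm_T M w, tm_X M n w).

Arguments tm_observation {R d S} M n w.

(* Main.v *)
Require Import Defs.
From HB Require Import structures.
From mathcomp Require Import all_boot all_order all_algebra.
From mathcomp Require Import finmap.
From mathcomp Require Import all_classical all_reals all_analysis.
From mathcomp Require Import measurable_realfun ring lra.

Set Implicit Arguments.
Unset Strict Implicit.
Unset Printing Implicit Defensive.

Import Order.TTheory GRing.Theory Num.Theory.
Import numFieldNormedType.Exports.

Local Open Scope classical_set_scope.
Local Open Scope ring_scope.

(** This is de Finetti's theorem for a standard Borel state space.

    A talent model is exchangeable because the observations are one fixed
    measurable function of the pair formed by the talent and the sequence of
    chance components, applied index by index. Permuting the indices of the
    chance components does not change the law of that pair: before and
    after, it is the product of the law of the talent and of the same i.i.d.
    law ([talent_model_exchangeable]).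

    Conversely let [mu] be the law of an exchangeable sequence, on the space
    of paths. For a measurable set [D] of states consider the proportion of
    visits to [D] over the block of times [4^k, 2 * 4^k[. Exchangeability
    leaves only two values for the probability that two coordinates both lie
    in [D], according to whether these coordinates are equal; hence the
    increments of the proportions have second moment at most [2 / 4^k]
    ([block_mean_increment_sqr]), and the proportions converge almost surely
    ([block_mean_cvg]). Their superior limit, [frequency D], is unchanged by
    finite permutations of the path. A coordinate [y j] may be exchanged
    with any later one, so in an expectation whose other factors ignore that
    exchange its indicator may be averaged over a far block, that is,
    replaced by the frequency ([integral_indic_frequency]). Doing this for
    every coordinate shows that the coordinates are a mixture of i.i.d.
    sequences: [mu (y 0 \in D 0, ..., y (N-1) \in D (N-1))] is the
    expectation of the product of the frequencies of the [D n]
    ([integral_prod_frequency]).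

    The mixture is realized by taking the whole path as the talent, an
    independent i.i.d. uniform sequence as the luck, and for [f] the
    quantile function of the limiting empirical distribution of the path.
    For this purpose the states are embedded in the line by the Borel
    isomorphism [phi]; the quantile is below [x] exactly when the uniform
    number is below the frequency of some closed level under [x]
    ([quantile_ltE]), so that de Finetti's identity gives the law of the
    quantiles ([quantile_law]), and a measurable left inverse of [phi]
    brings them back to the state space.

    The i.i.d. uniform sequence is extracted from one uniform number. Its
    binary digits are fair and independent since doubling modulo one forgets
    the first digit and preserves the uniform law ([unif_doubling]). The
    numbers made of the digits of even and of odd rank are therefore
    independent and uniform ([even_odd_indep]): their joint distribution
    function solves a self-similarity equation that has a single bounded
    solution. Keeping the first number as a term of the sequence and
    splitting the second one again, repeatedly, produces the sequence. *)

(** * Laws of sequences *)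

Definition seq_space d (S : measurableType d) :=
  g_sigma_algebraType
    (\bigcup_n preimage_set_system setT (fun y : nat -> S => y n) measurable).

Lemma seq_space_measurable d (S : measurableType d) (B : set (seq_space S)) :
  measurable B = product_sigma_algebra B.
Proof. by []. Qed.

Lemma measurable_coord d {S : measurableType d} n :
  measurable_fun setT (fun y : seq_space S => y n).
Proof.
move=> _ A mA; apply: sub_sigma_algebra; exists n => //.
by exists A.
Qed.

Lemma measurable_seq d d' (T : measurableType d) (S : measurableType d')
    (F : T -> seq_space S) :
  (forall n, measurable_fun setT (fun t => F t n)) -> measurable_fun setT F.
Proof.
move=> mF; apply: measurability; first by [].
by move=> _ [_ [n _ [A mA <-]] <-]; rewrite !setTI
  -[X in measurable X]setTI; exact: mF.
Qed.

Lemma cylinder_measurable d d' (T : measurableType d) (S : measurableType d')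
    (Y : nat -> T -> S) N (B : nat -> set S) :
  (forall n, measurable_fun setT (Y n)) ->
  (forall n, measurable (B n)) ->
  measurable [set w | forall n, (n < N)%N -> B n (Y n w)].
Proof.
move=> mY mB.
have -> : [set w | forall n, (n < N)%N -> B n (Y n w)] =
    \bigcap_(n < N) (Y n @^-1` B n) by apply/seteqP; split.
apply: fin_bigcap_measurable; first exact: finite_II.
by move=> n _; rewrite -[X in measurable X]setTI; exact: mY.
Qed.

(** Cylinders over a generating pi-system [G] form a pi-system that
    generates the product sigma-algebra. [G setT] pads two cylinders to a
    common length. *)
Lemma eq_joint_distribution (R : realType) d1 (O1 : measurableType d1)
    (P1 : probability O1 R) d2 (O2 : measurableType d2) (P2 : probability O2 R)
    d (S : measurableType d) (G : set (set S))
    (Y1 : nat -> O1 -> S) (Y2 : nat -> O2 -> S) :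
  measurable = <<s G >> -> setI_closed G -> G setT ->
  (forall n, measurable_fun setT (Y1 n)) ->
  (forall n, measurable_fun setT (Y2 n)) ->
  (forall N (B : nat -> set S), (forall n, G (B n)) ->
    P1 [set w | forall n, (n < N)%N -> B n (Y1 n w)] =
    P2 [set w | forall n, (n < N)%N -> B n (Y2 n w)]) ->
  same_joint_distribution P1 P2 Y1 Y2.
Proof.
move=> GE GI GT mY1 mY2 H B mB.
pose F1 w : seq_space S := fun n => Y1 n w.
pose F2 w : seq_space S := fun n => Y2 n w.
have mF1 : measurable_fun setT F1 by exact: measurable_seq.
have mF2 : measurable_fun setT F2 by exact: measurable_seq.
pose C := [set C : set (seq_space S) | exists N (D : nat -> set S),
  [/\ forall n, G (D n), forall n, (N <= n)%N -> D n = setT &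
      C = [set y | forall n, D n (y n)]]].
have HC N (D : nat -> set S) : (forall n, (N <= n)%N -> D n = setT) ->
    [set y : nat -> S | forall n, D n (y n)] =
    [set y | forall n, (n < N)%N -> D n (y n)].
  move=> DT; apply/seteqP; split => y /= yD n; first by move=> _; exact: yD.
  by have [/yD//|/DT ->] := ltnP n N.
have mG A : G A -> measurable A by rewrite GE; exact: sub_sigma_algebra.
apply: (@measure_unique _ R (seq_space S) C (fun=> setT) _ _ _ _
   (pushforward P1 F1) (pushforward P2 F2)) => //.
- apply/seteqP; split; last first.
    apply: smallest_sub; first exact: sigma_algebra_measurable.
    move=> _ [N [D [GD DT ->]]]; rewrite (HC N)//.
    apply: (@cylinder_measurable _ _ (seq_space S) S (fun n y => y n)) => n.
      exact: measurable_coord.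
    exact: mG.
  apply: smallest_sub; first exact: smallest_sigma_algebra.
  move=> _ [n _ [A mA <-]]; rewrite setTI.
  suff : <<s G >> `<=` [set A | <<s C >> ((fun y : nat -> S => y n) @^-1` A)].
    by apply; rewrite -GE.
  apply: smallest_sub.
    pose seqC := g_sigma_algebraType C.
    split; first by rewrite /= preimage_set0; exact: (@measurable0 _ seqC).
      move=> D /= mD; rewrite setTD preimage_setC.
      exact: (@measurableC _ seqC).
    move=> F mF /=; rewrite preimage_bigcup.
    exact: (@bigcupT_measurable _ seqC).
  move=> D GD; apply: sub_sigma_algebra.
  exists n.+1, (fun i => if i == n then D else setT); split.
  - by move=> i; case: ifP.
  - by move=> i ni; rewrite gtn_eqF.
  - apply/seteqP; split=> y /=; first by move=> Dy i; case: eqP => [->|].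
    by move=> /(_ n); rewrite eqxx.
- move=> _ _ [N1 [D1 [GD1 DT1 ->]]] [N2 [D2 [GD2 DT2 ->]]].
  exists (maxn N1 N2), (fun n => D1 n `&` D2 n); split.
  + by move=> n; exact: GI.
  + by move=> n; rewrite geq_max => /andP[/DT1 -> /DT2 ->]; rewrite setTI.
  + apply/seteqP; split => y /=; first by move=> [? ?] n; split.
    by move=> yD; split => n; have [] := yD n.
- move=> _; exists 0%N, (fun=> setT); split => //.
  by apply/seteqP; split.
- by rewrite bigcup_const//; exists 0%N.
- move=> _ [N [D [GD DT ->]]]; rewrite (HC N)// /pushforward.
  exact: H.
- move=> _; rewrite /= /pushforward.
  apply: (le_lt_trans _ (ltry 1%R)); apply: probability_le1.
  by rewrite -[X in measurable X]setTI; exact: mF1.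
Qed.

Lemma measurable_reindex d (S : measurableType d) (s : nat -> nat) :
  measurable_fun setT (fun y : seq_space S => (fun n => y (s n)) : seq_space S).
Proof. by apply: measurable_seq => n; exact: measurable_coord. Qed.

(** * A talent model is exchangeable *)

Lemma mutually_independent_reindex d (Om : measurableType d) (R : realType)
    (P : probability Om R) d' (E : measurableType d') (X : nat -> {RV P >-> E})
    (s : nat -> nat) N (B : nat -> set E) :
  mutually_independent X -> injective s -> (forall n, measurable (B n)) ->
  P [set w | forall n, (n < N)%N -> B n (X (s n) w)] =
    (\prod_(n < N) P (X (s n) @^-1` B n))%E.
Proof.
move=> Xi si mB.
pose J := [fset s n | n in iota 0 N]%fset.
(* an index off the range of s carries no constraint *)
pose C m := if pselect (exists n, s n = m) is left h then B (projT1 (cid h))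
            else setT.
have Cs n : C (s n) = B n.
  rewrite /C; case: pselect => [h|[]]; last by exists n.
  by case: cid => /= m /si ->.
have mC m : measurable (C m) by rewrite /C; case: pselect.
have -> : [set w | forall n, (n < N)%N -> B n (X (s n) w)] =
    \bigcap_(m in [set` J]) X m @^-1` C m.
  apply/seteqP; split=> w /=.
    move=> H m /= /imfsetP[n /=]; rewrite mem_iota/= add0n => nN ->.
    by rewrite Cs; exact: H.
  move=> H n nN; rewrite -Cs; apply: H => /=.
  by apply/imfsetP; exists n => //=; rewrite mem_iota.
rewrite Xi// big_imfset/=; last by move=> ? ? _ _ /si.
rewrite -(big_mkord predT (fun n => P (X (s n) @^-1` B n))) /index_iota subn0.
rewrite undup_id ?iota_uniq//.
by apply: eq_bigr => i _; rewrite Cs.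
Qed.

Definition sample_path d d' (T : measurableType d) (S : measurableType d')
    (X : nat -> {mfun T >-> S}) : T -> seq_space S := fun w n => X n w.

Lemma measurable_sample_path d d' (T : measurableType d) (S : measurableType d')
    (X : nat -> {mfun T >-> S}) : measurable_fun setT (sample_path X).
Proof. by apply: measurable_seq => n; exact: measurable_funPT. Qed.

HB.instance Definition _ d d' (T : measurableType d) (S : measurableType d')
    (X : nat -> {mfun T >-> S}) :=
  isMeasurableFun.Build _ _ _ _ (sample_path X) (measurable_sample_path X).

(** Both for [s] and for the identity, the pair of the talent and of the
    reindexed chance components has the product of its marginals as law, and
    these marginals do not depend on [s]. The observations are the image [F]
    of this pair. *)
Lemma talent_model_exchangeable (R : realType) d (S : measurableType d)
    (M : talent_model R S) (s : nat -> nat) : injective s ->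
  same_joint_distribution (tm_P M) (tm_P M)
    (tm_observation M) (fun n => tm_observation M (s n)).
Proof.
move=> si B mB.
set P := tm_P M; set T := tm_T M; set X := tm_X M.
have Xi : mutually_independent X by exact: (@tm_X_independent _ _ _ M).
have Xs_law : same_joint_distribution P P (fun n => X n) (fun n => X (s n)).
  apply: (@eq_joint_distribution _ _ _ _ _ _ _ _ _ measurable) => //.
  - by rewrite sigma_algebra_id//; exact: sigma_algebra_measurable.
  - exact: measurableI.
  - move=> N D mD; rewrite (mutually_independent_reindex _ Xi (fun _ _ => id))//.
    rewrite (mutually_independent_reindex _ Xi si)//; apply: eq_bigr => i _.
    exact: (@tm_X_identically_distributed _ _ _ M).
pose F (z : tm_ET M * seq_space (tm_EX M)) : seq_space S :=
  fun n => tm_f M (z.1, z.2 n).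
have mF : measurable_fun setT F.
  apply: measurable_seq => n.
  apply: (measurableT_comp (measurable_funPT (tm_f M))).
  apply: measurable_fun_pair; first exact: measurable_fst.
  exact: (measurableT_comp (measurable_coord n) measurable_snd).
have mFB : measurable (F @^-1` B).
  by rewrite -[X in measurable X]setTI; exact: mF.
have key (s' : nat -> nat) :
    same_joint_distribution P P (fun n => X n) (fun n => X (s' n)) ->
    joint_distribution P (fun n => tm_observation M (s' n)) B =
    (distribution P T \x distribution P (sample_path X))%E (F @^-1` B).
  move=> Xl.
  pose Z w := (T w, sample_path (fun n => X (s' n)) w).
  have mZ : measurable_fun setT Z.
    by apply: measurable_fun_pair;
      [exact: measurable_funPT|exact: measurable_sample_path].
  pose Zm : {mfun _ >-> _} := HB.pack Z (isMeasurableFun.Build _ _ _ _ Z mZ).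
  have -> : joint_distribution P (fun n => tm_observation M (s' n)) B =
    distribution P Zm (F @^-1` B) by [].
  apply/esym; apply: product_measure_unique => // C D mC mD.
  rewrite /distribution /pushforward /=.
  pose D' := [set x : seq_space (tm_EX M) | D (fun n => x (s' n))].
  have mD' : measurable D'.
    rewrite -[X in measurable X]setTI.
    exact: (@measurable_reindex _ (tm_EX M) s' measurableT D mD).
  apply: (etrans (@tm_T_independent _ _ _ M C D' mC mD')).
  by congr (_ * _)%E; exact/esym/(Xl D mD).
have /= -> := key id (fun _ _ => erefl).
by have /= -> := key s Xs_law.
Qed.

Lemma eq_joint_distribution_reindex (R : realType)
    d1 (O1 : measurableType d1) (P1 : probability O1 R)
    d2 (O2 : measurableType d2) (P2 : probability O2 R)
    d (S : measurableType d) (Y1 : nat -> O1 -> S) (Y2 : nat -> O2 -> S)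
    (s : nat -> nat) : same_joint_distribution P1 P2 Y1 Y2 ->
  same_joint_distribution P1 P2 (fun n => Y1 (s n)) (fun n => Y2 (s n)).
Proof.
move=> Y12 B mB.
apply: (Y12 [set y | B (fun n => y (s n))]).
rewrite -seq_space_measurable -[X in measurable X]setTI.
exact: (@measurable_reindex _ S s measurableT B mB).
Qed.

(** Exchangeability is a property of the law alone. *)
Lemma talent_model_law_exchangeable (R : realType) d (S : measurableType d)
    d' (Om : measurableType d') (P : probability Om R) (Y : nat -> Om -> S)
    (M : talent_model R S) :
  same_joint_distribution (tm_P M) P (tm_observation M) Y -> exchangeable P Y.
Proof.
move=> MY s [/bij_inj si _] B mB.
rewrite -(MY B mB) (talent_model_exchangeable M si mB).
exact: (eq_joint_distribution_reindex s MY).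
Qed.

(** * An i.i.d. uniform sequence from one uniform variable *)

Section uniform_sequence.
Variable R : realType.

Let setR_eq (A B : set R) : (forall z : R, A z <-> B z) -> A = B.
Proof. by move=> AB; apply/seteqP; split => z /AB. Qed.

Definition unif : probability (measurableTypeR R) R :=
  uniform_prob (@ltr01 R).

Definition clamp (x : R) : R := Num.min 1 (Num.max 0 x).

Lemma clampP x : [\/ x <= 0 /\ clamp x = 0, 0 <= x <= 1 /\ clamp x = x |
  1 <= x /\ clamp x = 1].
Proof.
rewrite /clamp; have [x0|x0] := leP x 0; first by rewrite min_r //; constructor 1.
have [x1|x1] := leP 1 x; first by constructor 3.
by constructor 2; rewrite !ltW.
Qed.

Lemma clamp0 x : x <= 0 -> clamp x = 0.
Proof. by case: (clampP x) => -[? ->]; lra. Qed.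

Lemma clamp1 x : 1 <= x -> clamp x = 1.
Proof. by case: (clampP x) => -[? ->]; lra. Qed.

Lemma unif_lebesgue (A : set (measurableTypeR R)) : measurable A ->
  unif A = lebesgue_measure (A `&` `[0, 1]%classic).
Proof.
move=> mA; rewrite /unif /= /uniform_prob integral_uniform_pdf.
rewrite (eq_integral (cst 1%E)); last first.
  by move=> x; rewrite inE/= in_itv/= => -[_ x01]; rewrite /uniform_pdf x01 subr0 invr1.
by rewrite integral_cst ?mul1e//; exact: measurableI.
Qed.

Lemma unif_ray (x : R) : unif `]-oo, x[%classic = (clamp x)%:E.
Proof.
rewrite unif_lebesgue// /clamp.
have [x0|x0] := leP x 0.
  rewrite (_ : _ `&` _ = set0) ?measure0 ?min_r//.
  by apply: setR_eq => z; split=> //=; rewrite !in_itv/= => -[] ? /andP[]; lra.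
have [x1|x1] := leP 1 x.
  rewrite (_ : _ `&` _ = `[0, 1[%classic `|` (`]-oo, x[%classic `&` [set 1])); last first.
    apply: setR_eq => z; split=> /=; rewrite !in_itv/=.
      move=> [zx /andP[z0]]; rewrite le_eqVlt => /orP[/eqP z1|z1]; [right|left] => //.
      by rewrite z0.
    move=> [/andP[z0 z1]|[zx z1]]; last first.
      by rewrite z1 in zx *; rewrite ler01 lexx.
    split; [exact: lt_le_trans x1|by rewrite z0 ltW].
  apply/eqP; rewrite eq_le; apply/andP; split.
    apply: le_trans (measureU2 _ _ _) _ => //=; first exact: measurableI.
    rewrite lebesgue_measure_itv/= lte_fin ltr01 -[leRHS]adde0.
    rewrite leeD//; first by rewrite oppr0 adde0.
    rewrite -(lebesgue_measure_set1 1) le_measure ?inE//.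
    exact: measurableI.
  apply: (@le_trans _ _ (lebesgue_measure `[0, 1[%classic)); last first.
    by rewrite le_measure ?inE//; [apply: measurableU => //; exact: measurableI].
  by rewrite lebesgue_measure_itv/= lte_fin ltr01 oppr0 adde0.
rewrite (_ : _ `&` _ = `[0, x[%classic).
  by rewrite lebesgue_measure_itv/= lte_fin x0 oppr0 adde0.
by apply: setR_eq => z; split=> /=; rewrite !in_itv/=; lra.
Qed.

(** Rays generate the Borel sets, so testing on rays shows both that [f] is
    uniform and that it is independent of [E]. *)
Lemma unif_indep d (T : measurableType d) (P : probability T R)
    (f : T -> measurableTypeR R) (E : set T) :
  measurable_fun setT f -> measurable E ->
  (forall x, P (f @^-1` `]-oo, x[%classic `&` E) = (clamp x)%:E * P E)%E ->
  forall A, measurable A -> (P (f @^-1` A `&` E) = unif A * P E)%E.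
Proof.
move=> mf mE fE A mA.
have PE : P E \is a fin_num by exact: fin_num_measure.
pose r : {nonneg R} := NngNum (fine_ge0 (measure_ge0 P E)).
have <- : mscale r unif A = (unif A * P E)%E.
  by rewrite /mscale/= fineK// muleC.
apply: (@measure_unique _ R (measurableTypeR R) (@RGenInftyO.G R)
  (fun n => `]-oo, n%:R[%classic) _ _ _ _
  (pushforward (mrestr P mE) f) (mscale r unif)) => //.
- exact: RGenInftyO.measurableE.
- move=> _ _ [x ->] [y ->]; exists (Num.min x y).
  by apply: setR_eq => z; split=> /=; rewrite !in_itv/= lt_min; 
      [move=> [-> ->]|move=> /andP[]].
- by move=> n; exists n%:R.
- apply/seteqP; split => // z _; exists (Num.truncn z).+1 => //=.
  by rewrite in_itv/= truncnS_gt.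
- by move=> _ [x ->]; rewrite /= /pushforward /mrestr fE /mscale/= unif_ray fineK// muleC.
- move=> n; rewrite /= /pushforward /mrestr.
  apply: (le_lt_trans _ (ltry 1%R)); apply: probability_le1.
  by apply: measurableI => //; rewrite -[X in measurable X]setTI; exact: mf.
Qed.

(** ** The doubling map and its digit *)

Definition digit (u : R) : bool := 2^-1 <= u.
Definition doubling (u : measurableTypeR R) : measurableTypeR R :=
  2 * u - (digit u)%:R.

Lemma measurable_digit i :
  measurable ([set u | digit u = i] : set (measurableTypeR R)).
Proof.
case: i.
  rewrite (_ : mkset _ = `[2^-1, +oo[%classic)//.
  by apply: setR_eq => z; split=> /=; rewrite /digit in_itv/= andbT.
rewrite (_ : mkset _ = `]-oo, 2^-1[%classic)//.
by apply: setR_eq => z; split=> /=; rewrite /digit in_itv/= ltNge;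
  [move=> ->|move/negbTE].
Qed.

Lemma measurable_digitr : measurable_fun setT 
  (fun u : measurableTypeR R => (digit u)%:R : R).
Proof.
rewrite (_ : (fun _ => _) = \1_[set u | digit u = true]).
  apply: measurable_indic; exact: measurable_digit.
apply/funext => u; rewrite indicE.
by case E : (digit u); [rewrite mem_set|rewrite memNset//= E].
Qed.

Lemma measurable_doubling : measurable_fun setT doubling.
Proof.
apply: measurable_funB; last exact: measurable_digitr.
by apply: measurable_funM => //; exact: measurable_cst.
Qed.

(** On each half of the unit interval the doubling map is affine of slope
    two onto the whole interval: the first binary digit of a uniform number
    is a fair coin, independent of the number made of the following digits. *)
Lemma unif_doubling i (A : set (measurableTypeR R)) : measurable A ->
  unif (doubling @^-1` A `&` [set u | digit u = i]) = (2^-1%:E * unif A)%E.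
Proof.
move=> mA.
have Ui : unif [set u | digit u = i] = 2^-1%:E.
  have U0 : unif [set u | digit u = false] = 2^-1%:E.
    rewrite (_ : mkset _ = `]-oo, 2^-1[%classic).
      rewrite unif_ray /clamp; congr EFin.
      by rewrite max_r ?min_r//; lra.
    by apply: setR_eq => z; split=> /=; rewrite /digit in_itv/= ltNge;
  [move=> ->|move/negbTE].
  case: i => //; rewrite (_ : mkset _ = ~` [set u | digit u = false]).
    rewrite probability_setC; last exact: measurable_digit.
    by rewrite U0 -EFinB; congr EFin; lra.
  by apply: setR_eq => z; split=> /=; case: digit.
rewrite muleC -Ui; apply: unif_indep => //.
- exact: measurable_doubling.
- exact: measurable_digit.
move=> x; rewrite Ui; case: i {Ui}.
  rewrite (_ : _ `&` _ = `]-oo, (x + 1) / 2[%classic `\` `]-oo, 2^-1[%classic).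
    rewrite measureD//=; last by rewrite unif_ray ltry.
    rewrite (_ : _ `&` _ = `]-oo, Num.min ((x+1)/2) 2^-1[%classic).
      rewrite !unif_ray -EFinB -EFinM; congr EFin.
      by have [h|h] := leP ((x + 1) / 2) 2^-1; case: (clampP ((x + 1) / 2)) => -[? ->];
        case: (clampP x) => -[? ->]; case: (clampP 2^-1) => -[? E]; rewrite ?E; lra.
    by apply: setR_eq => z; split=> /=; rewrite !in_itv/= lt_min; 
      [move=> [-> ->]|move=> /andP[]].
  apply: setR_eq => z; split=> /=; rewrite !in_itv/= /doubling /digit.
    by move=> [+ h]; rewrite h/= => ?; split; [lra|apply/negP; rewrite -leNgt].
  by move=> [h /negP]; rewrite -leNgt => z2; rewrite z2/=; split => //; lra.
rewrite (_ : _ `&` _ = `]-oo, Num.min (x/2) 2^-1[%classic).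
  rewrite !unif_ray -EFinM; congr EFin.
  by have [h|h] := leP (x / 2) 2^-1; case: (clampP (x / 2)) => -[? E1]; rewrite ?E1;
    case: (clampP x) => -[? ->]; case: (clampP 2^-1) => -[? E]; rewrite ?E; lra.
apply: setR_eq => z; split=> /=; rewrite !in_itv/= /doubling /digit lt_min.
  move=> [+ h]; rewrite h/= => ?; move/negbT : h; rewrite -ltNge => h.
  by apply/andP; split; lra.
by move=> /andP[h zh]; rewrite leNgt zh/=; split => //; lra.
Qed.

End uniform_sequence.

Section even_digits.
Variable R : realType.
Local Notation unif := (@unif R).
Local Notation doubling := (@doubling R).
Local Notation clamp := (@clamp R).
Implicit Types u : measurableTypeR R.

(** Truncations of the number whose binary digits are those of [u] of rank
    0, 2, 4, and so on. Defined by peeling off the leading digits, they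
    satisfy a recursion that passes to the limit as [even_partE]. *)
Fixpoint even_approx n u : R :=
  if n is n'.+1 then
    (digit u)%:R / 2 + even_approx n' (doubling (doubling u)) / 2
  else 0.

Definition even_part u : measurableTypeR R := limn (even_approx ^~ u).
Definition odd_part u : measurableTypeR R := even_part (doubling u).

Lemma even_approx_ge0 n u : 0 <= even_approx n u.
Proof.
elim: n u => //= n IH u; have := IH (doubling (doubling u)).
by case: digit => /=; lra.
Qed.

Lemma even_approx_le1 n u : even_approx n u <= 1.
Proof.
elim: n u => //= n IH u.
by have := IH (doubling (doubling u)); case: digit => /=; lra.
Qed.

Lemma even_approx_nondecreasing u : nondecreasing_seq (even_approx ^~ u).
Proof.
apply/nondecreasing_seqP => n.
elim: n u => [|n IH] u; first exact: even_approx_ge0.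
by apply: lerD => //; apply: ler_wpM2r => //; exact: IH.
Qed.

Lemma even_approx_is_cvg u : cvgn (even_approx ^~ u).
Proof.
apply: nondecreasing_is_cvgn; first exact: even_approx_nondecreasing.
by exists 1 => _ [n _ <-]; exact: even_approx_le1.
Qed.

(** Once the first digit is removed, even and odd ranks trade places. *)
Lemma even_partE u : even_part u = (digit u)%:R / 2 + odd_part (doubling u) / 2.
Proof.
apply/cvg_lim => //; rewrite -(cvg_shiftS (even_approx ^~ u)) /=.
apply: cvgD; first exact: cvg_cst.
apply: cvgM; last exact: cvg_cst.
exact: even_approx_is_cvg.
Qed.

Lemma even_part_itv u : 0 <= even_part u <= 1.
Proof.
apply/andP; split.
  apply: limr_ge; first exact: even_approx_is_cvg.
  by apply: nearW => n; exact: even_approx_ge0.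
apply: limr_le; first exact: even_approx_is_cvg.
by apply: nearW => n; exact: even_approx_le1.
Qed.

Lemma measurable_even_part : measurable_fun setT even_part.
Proof.
apply: (@measurable_fun_cvg _ _ _ setT (fun n u => even_approx n u)); last first.
  by move=> u _; exact: even_approx_is_cvg.
elim=> [|n IH] /=; first exact: measurable_cst.
apply: measurable_funD; apply: measurable_funM; try exact: measurable_cst.
  exact: measurable_digitr.
apply: (measurableT_comp IH).
by apply: (measurableT_comp (@measurable_doubling R)); exact: measurable_doubling.
Qed.

Lemma measurable_odd_part : measurable_fun setT odd_part.
Proof. exact: (measurableT_comp measurable_even_part (@measurable_doubling R)). Qed.

(** The uniqueness principle for self-similarity equations: [F] is the
    difference of two bounded solutions. *)
Lemma halving_eq0 (T : Type) (F : T -> R) :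
  (forall t, `|F t| <= 1) ->
  (forall t, F t = 0 \/ exists t', F t = F t' / 2) -> forall t, F t = 0.
Proof.
move=> F1 FE t.
have Fn n t' : `|F t'| <= 2^-1 ^+ n.
  elim: n t' => [|n IH] t'; first by rewrite expr0.
  have [->|[s ->]] := FE t'; first by rewrite normr0 exprn_ge0.
  rewrite normrM exprS mulrC ler_pM//.
  by rewrite ger0_norm.
apply/eqP; rewrite -normr_eq0 eq_le normr_ge0 andbT.
have c : (2^-1 : R) ^+ n @[n --> \oo] --> 0.
  by apply: cvg_expr; rewrite ger0_norm ?invf_lt1 ?ltr1n.
rewrite -(cvg_lim _ c)//; apply: limr_ge; first by apply/cvg_ex; exists 0.
by apply: nearW => n; exact: Fn.
Qed.

Lemma clampE (x : R) : clamp x = clamp (2 * x) / 2 + clamp (2 * x - 1) / 2.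
Proof.
by case: (clampP x) => -[? ->]; case: (clampP (2 * x)) => -[? ->];
  case: (clampP (2 * x - 1)) => -[? ->]; lra.
Qed.

Definition ray (x : R) : set (measurableTypeR R) := `]-oo, x[%classic.
Lemma rayE (x y : R) : ray x y = (y < x) :> Prop.
Proof. by rewrite /ray /= in_itv. Qed.
Lemma measurable_ray x : measurable (ray x). Proof. exact: measurable_itv. Qed.

Definition joint_cdf (x y : R) : R :=
  fine (unif (even_part @^-1` ray x `&` odd_part @^-1` ray y)).
Definition even_cdf (x : R) : R := fine (unif (even_part @^-1` ray x)).

Lemma measurable_even_preimage A :
  measurable A -> measurable (even_part @^-1` A).
Proof.
by move=> mA; rewrite -[X in measurable X]setTI; exact: measurable_even_part.
Qed.

Lemma measurable_odd_preimage A :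
  measurable A -> measurable (odd_part @^-1` A).
Proof.
by move=> mA; rewrite -[X in measurable X]setTI; exact: measurable_odd_part.
Qed.

Lemma measurable_doubling_preimage A :
  measurable A -> measurable (doubling @^-1` A).
Proof.
by move=> mA; rewrite -[X in measurable X]setTI; exact: measurable_doubling.
Qed.

Lemma measurable_joint_ray x y :
  measurable (even_part @^-1` ray x `&` odd_part @^-1` ray y).
Proof.
by apply: measurableI; [apply: measurable_even_preimage|
  apply: measurable_odd_preimage]; exact: measurable_ray.
Qed.

(** Conditioning on the first digit. *)
Lemma unif_split_digit (A A0 A1 : set (measurableTypeR R)) :
  measurable A0 -> measurable A1 ->
  (forall u, A u <-> if digit u then A1 (doubling u) else A0 (doubling u)) ->
  fine (unif A) = fine (unif A0) / 2 + fine (unif A1) / 2.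
Proof.
move=> mA0 mA1 AE.
have -> : A = (doubling @^-1` A0 `&` [set u | digit u = false]) `|`
              (doubling @^-1` A1 `&` [set u | digit u = true]).
  apply/seteqP; split => u /=.
    by move=> /AE; case: (digit u) => ?; [right|left].
  by case => -[? du]; apply/AE; rewrite du.
have mB0 : measurable (doubling @^-1` A0 `&` [set u | digit u = false]).
  by apply: measurableI; [exact: measurable_doubling_preimage|exact: measurable_digit].
have mB1 : measurable (doubling @^-1` A1 `&` [set u | digit u = true]).
  by apply: measurableI; [exact: measurable_doubling_preimage|exact: measurable_digit].
rewrite measureU//; last first.
  by apply/seteqP; split => u //= [[_ ->] []].
transitivity (fine (2^-1%:E * unif A0 + 2^-1%:E * unif A1)%E).
  by congr (fine (_ + _)%E); exact: unif_doubling.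
rewrite fineD ?fin_numM ?fin_num_measure//.
by rewrite !fineM ?fin_num_measure//= mulrC [X in _ + X]mulrC.
Qed.

Lemma unif_doubling_preserve A : measurable A ->
  unif (doubling @^-1` A) = unif A.
Proof.
move=> mA; rewrite -[LHS]fineK; last first.
  by apply: fin_num_measure; exact: measurable_doubling_preimage.
rewrite -[RHS]fineK; last exact: fin_num_measure.
congr EFin; rewrite (unif_split_digit mA mA); first by lra.
by move=> u; case: digit.
Qed.

Lemma even_cdfE x : even_cdf x = even_cdf (2 * x) / 2 + even_cdf (2 * x - 1) / 2.
Proof.
have mE a := measurable_even_preimage (measurable_ray a).
have mO a := measurable_doubling_preimage (mE a).
rewrite /even_cdf -(unif_doubling_preserve (mE (2 * x))).
rewrite -(unif_doubling_preserve (mE (2 * x - 1))).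
apply: unif_split_digit => //.
move=> u; rewrite /preimage/= !rayE even_partE.
by case: digit => /=; split; rewrite -/(odd_part _); lra.
Qed.

(** Removing the first digit makes even and odd ranks trade places, whence the
    exchanged arguments on the right. *)
Lemma joint_cdfE x y :
  joint_cdf x y = joint_cdf y (2 * x) / 2 + joint_cdf y (2 * x - 1) / 2.
Proof.
rewrite /joint_cdf; apply: unif_split_digit; do ?exact: measurable_joint_ray.
move=> u.
rewrite /preimage/= !rayE (even_partE u).
by case: digit => /=; rewrite -/(odd_part u); split => -[? ?]; split => //; lra.
Qed.


Lemma even_cdf_itv x : 0 <= even_cdf x <= 1.
Proof.
rewrite /even_cdf fine_ge0//= -[leRHS]/(fine 1%:E) fine_le ?fin_num_measure//.
  by apply: measurable_even_preimage; exact: measurable_ray.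
by apply: probability_le1; apply: measurable_even_preimage; exact: measurable_ray.
Qed.

Lemma even_cdf0 x : x <= 0 -> even_cdf x = 0.
Proof.
move=> x0; rewrite /even_cdf (_ : _ @^-1` _ = set0) ?measure0//.
apply/seteqP; split => u //=; rewrite rayE.
by have /andP[? ?] := even_part_itv u; lra.
Qed.

Lemma even_ray1 x : 1 < x -> even_part @^-1` ray x = setT.
Proof.
move=> x0; apply/seteqP; split => u //= _; rewrite rayE.
by have /andP[? ?] := even_part_itv u; lra.
Qed.

Lemma even_cdf1 x : 1 < x -> even_cdf x = 1.
Proof. by move=> x1; rewrite /even_cdf even_ray1// probability_setT. Qed.

(** [clamp] is the uniform distribution function. One of the two terms of the
    self-similarity equation always falls where the error vanishes, since
    [2 * x - 1 <= 0] or [1 < 2 * x]; the other one halves the error. *)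
Lemma even_cdf_clamp x : even_cdf x = clamp x.
Proof.
apply/eqP; rewrite -subr_eq0; apply/eqP; move: x.
have F0 x : x <= 0 -> even_cdf x - clamp x = 0.
  by move=> x0; rewrite even_cdf0// clamp0// subrr.
have F1 x : 1 < x -> even_cdf x - clamp x = 0.
  by move=> x1; rewrite even_cdf1// clamp1 ?subrr// ltW.
apply: halving_eq0 => x.
  rewrite ler_norml; have /andP[? ?] := even_cdf_itv x.
  by case: (clampP x) => -[? ->]; apply/andP; split; lra.
right; rewrite even_cdfE clampE; have [x1|x1] := leP (2 * x) 1.
  by exists (2 * x); have := F0 (2 * x - 1); lra.
by exists (2 * x - 1); have := F1 (2 * x) x1; lra.
Qed.

Lemma unif_even A : measurable A -> unif (even_part @^-1` A) = unif A.
Proof.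
move=> mA; have := @unif_indep _ _ _ unif even_part setT measurable_even_part
  measurableT _ A mA.
rewrite setIT probability_setT mule1; apply => x.
rewrite setIT mule1 -even_cdf_clamp fineK//.
by apply: fin_num_measure; apply: measurable_even_preimage; exact: measurable_ray.
Qed.

Lemma unif_odd A : measurable A -> unif (odd_part @^-1` A) = unif A.
Proof.
move=> mA; rewrite -(unif_even mA).
exact: (unif_doubling_preserve (measurable_even_preimage mA)).
Qed.

(** Same mechanism as for one variable: the error vanishes as soon as its second
    argument leaves the unit interval, on the right of it because the marginal
    law is already known. *)
Lemma joint_cdf_clamp x y : joint_cdf x y = clamp x * clamp y.
Proof.
apply/eqP; rewrite -subr_eq0; apply/eqP; move: x y.
pose F (p : R * R) := joint_cdf p.1 p.2 - clamp p.1 * clamp p.2.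
suff F_eq0 p : F p = 0 by move=> x y; exact: (F_eq0 (x, y)).
have F0 x y : y <= 0 -> F (x, y) = 0.
  move=> y0; rewrite /F/= /joint_cdf (_ : _ `&` _ = set0); last first.
    apply/seteqP; split => u //= []; rewrite !rayE.
    by have /andP[? ?] := even_part_itv (doubling u); rewrite /odd_part; lra.
  by rewrite measure0 (clamp0 y0) mulr0 subr0.
have F1 x y : 1 < y -> F (x, y) = 0.
  move=> y1; rewrite /F/= /joint_cdf (_ : odd_part @^-1` _ = setT); last first.
    apply/seteqP; split => u //= _; rewrite rayE.
    by have /andP[? ?] := even_part_itv (doubling u); rewrite /odd_part; lra.
  rewrite setIT -/(even_cdf x) even_cdf_clamp.
  by rewrite (clamp1 (ltW y1)) mulr1 subrr.
apply: halving_eq0 => {p} -[x y].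
  rewrite ler_norml /F/=.
  have /andP[? ?] : 0 <= joint_cdf x y <= 1.
    rewrite /joint_cdf fine_ge0//= -[leRHS]/(fine 1%:E).
    have mE := measurable_joint_ray x y.
    by rewrite fine_le ?fin_num_measure//; exact: probability_le1.
  by case: (clampP x) => -[? ->]; case: (clampP y) => -[? ->]; apply/andP; split; nra.
have FE : F (x, y) = F (y, 2 * x) / 2 + F (y, 2 * x - 1) / 2.
  by rewrite /F/= joint_cdfE [clamp x]clampE; ring.
right; rewrite FE; have [x1|x1] := leP (2 * x) 1.
  by exists (y, 2 * x); have := F0 y (2 * x - 1); lra.
by exists (y, 2 * x - 1); have := F1 y (2 * x) x1; lra.
Qed.

(** From rays to Borel sets, one coordinate at a time. *)
Lemma even_odd_indep A B : measurable A -> measurable B ->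
  unif (even_part @^-1` A `&` odd_part @^-1` B) = (unif A * unif B)%E.
Proof.
move=> mA mB.
have fin E : measurable E -> unif E \is a fin_num by exact: fin_num_measure.
have oy y : unif (odd_part @^-1` ray y) = (clamp y)%:E.
  by rewrite unif_odd; [exact: unif_ray|exact: measurable_ray].
have hA y : unif (even_part @^-1` A `&` odd_part @^-1` ray y) =
    (unif A * (clamp y)%:E)%E.
  rewrite -oy; apply: (unif_indep measurable_even_part) => //.
    by apply: measurable_odd_preimage; exact: measurable_ray.
  move=> x; rewrite oy -EFinM -joint_cdf_clamp fineK//; apply: fin.
  exact: measurable_joint_ray.
rewrite setIC muleC -(unif_even mA).
apply: (unif_indep measurable_odd_part) => //; first exact: measurable_even_preimage.
by move=> y; rewrite setIC unif_even// muleC; exact: hA.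
Qed.

(** The even part of what the previous terms have left of the digits of [u]. *)
Definition unif_seq n u : measurableTypeR R := even_part (iter n odd_part u).

Lemma measurable_unif_seq n : measurable_fun setT (unif_seq n).
Proof.
apply: (measurableT_comp measurable_even_part).
elim: n => [|n IH]; first exact: measurable_id.
exact: (measurableT_comp measurable_odd_part IH).
Qed.

Lemma unif_seq_law n A : measurable A -> unif (unif_seq n @^-1` A) = unif A.
Proof.
elim: n A => [|n IH] A mA; first exact: unif_even.
rewrite -(IH A mA) -[in RHS]unif_odd; last first.
  by rewrite -[X in measurable X]setTI; exact: measurable_unif_seq.
by congr (unif _); apply/seteqP; split => u; rewrite /preimage/= /unif_seq iterSr.
Qed.

Lemma unif_seq_indep N (B : nat -> set (measurableTypeR R)) :
  (forall n, measurable (B n)) ->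
  unif [set u | forall n, (n < N)%N -> B n (unif_seq n u)] =
    (\prod_(n < N) unif (B n))%E.
Proof.
elim: N B => [|N IH] B mB.
  rewrite big_ord0 (_ : mkset _ = setT) ?probability_setT//.
  by apply/seteqP; split.
rewrite big_ord_recl -(IH (fun n => B n.+1))// -even_odd_indep//; last first.
  apply: (@cylinder_measurable _ _ _ _ unif_seq N (fun n => B n.+1)) => //.
  exact: measurable_unif_seq.
congr (unif _); apply/seteqP; split => u /=.
  move=> uB; split; first exact: (uB 0%N).
  by move=> n nN; have := uB n.+1 nN; rewrite /unif_seq iterSr.
by move=> [u0 uS] [|n]// nN; have := uS n nN; rewrite /unif_seq iterSr.
Qed.

End even_digits.

(** * Limiting frequencies along an exchangeable sequence *)

Lemma le_limn_sup (R : realType) (u v : R^nat) N :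
  bounded_fun u -> bounded_fun v -> (forall k, (N <= k)%N -> u k <= v k) ->
  limn_sup u <= limn_sup v.
Proof.
move=> ub vb uv; apply: ler_lim.
- by apply/cvg_ex; exists (inf (range (sups u))); apply: cvg_sups_inf;
    [exact: bounded_fun_has_ubound|exact: bounded_fun_has_lbound].
- by apply/cvg_ex; exists (inf (range (sups v))); apply: cvg_sups_inf;
    [exact: bounded_fun_has_ubound|exact: bounded_fun_has_lbound].
- exists N => // n /= Nn; apply: ge_sup; first by exists (u n); exists n => /=.
  move=> _ [k /= nk <-]; apply: le_trans (uv _ (leq_trans Nn nk)) _.
  apply: ub_le_sup; last by exists k.
  exact/has_ubound_sdrop/bounded_fun_has_ubound.
Qed.

Definition swapn (i j n : nat) : nat :=
  if n == i then j else if n == j then i else n.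

Lemma swapnK i j : involutive (swapn i j).
Proof.
move=> n; rewrite /swapn; have [->|ni] := eqVneq n i.
  by rewrite eqxx; case: eqP.
by have [->|nj] := eqVneq n j; rewrite ?eqxx ?(negPf ni) ?(negPf nj).
Qed.

Lemma swapn_finite_permutation i j : finite_permutation (swapn i j).
Proof.
split; first by exists (swapn i j); exact: swapnK.
apply: (sub_finite_set (B := [set i; j])); last exact: finite_set2.
move=> n /=; rewrite /swapn.
by have [->|ni] := eqVneq n i; [left|have [->|] := eqVneq n j; [right|]].
Qed.

Section frequency.
Context (R : realType) d (S : measurableType d).
Implicit Types (D : set S) (y : seq_space S) (k : nat).

(** The blocks move to infinity, so a finite permutation of [y] affects
    finitely many of the means; they grow geometrically, so the increments
    of the means are summable, which gives almost sure convergence. *)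
Definition block_mean D k y : R :=
  (\sum_(4 ^ k <= i < 2 * 4 ^ k) \1_D (y i)) / (4 ^ k)%:R.

(** A superior limit rather than a limit: monotonicity in [D] and invariance
    under finite permutations then hold for every path, without exceptional
    null sets. *)
Definition frequency D y : R := limn_sup (block_mean D ^~ y).

Definition block_weight k i : R :=
  if (4 ^ k <= i < 2 * 4 ^ k)%N then (4 ^ k)%:R^-1 else 0.

Lemma block_meanE D k y M : (2 * 4 ^ k <= M)%N ->
  block_mean D k y = \sum_(i < M) block_weight k i * \1_D (y i).
Proof.
move=> kM; rewrite /block_mean (big_nat_widen _ _ _ _ _ kM).
rewrite (big_nat_widenl _ 0)// big_mkord big_mkcond/= mulr_suml.
apply: eq_bigr => i _; rewrite /block_weight andbC.
by case: ifP; rewrite ?mul0r// mulrC.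
Qed.

Lemma pow4_gt0 k : 0 < (4 ^ k)%:R :> R.
Proof. by rewrite ltr0n expn_gt0. Qed.

Lemma block_mean_itv D k y : 0 <= block_mean D k y <= 1.
Proof.
rewrite /block_mean divr_ge0 ?sumr_ge0//= ler_pdivrMr ?pow4_gt0// mul1r.
apply: (@le_trans _ _ (\sum_(4 ^ k <= i < 2 * 4 ^ k) 1)).
  by apply: ler_sum => i _; rewrite indicE lern1 leq_b1.
by rewrite sumr_const_nat mul2n -addnn addnK.
Qed.

Lemma block_meanT k y : block_mean setT k y = 1.
Proof.
rewrite /block_mean (eq_bigr (fun=> 1)); last by move=> i _; rewrite indicT.
by rewrite sumr_const_nat mul2n -addnn addnK divff// gt_eqF// pow4_gt0.
Qed.

Lemma sum_block_weight k M : (2 * 4 ^ k <= M)%N ->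
  \sum_(i < M) block_weight k i = 1.
Proof.
move=> kM; rewrite -(block_meanT k point) (block_meanE _ _ kM).
by apply: eq_bigr => i _; rewrite indicT mulr1.
Qed.

Lemma le_block_mean D D' k y : D `<=` D' -> block_mean D k y <= block_mean D' k y.
Proof.
move=> DD'; rewrite ler_pM2r ?invr_gt0 ?pow4_gt0//.
apply: ler_sum => i _; rewrite !indicE ler_nat.
by case: (boolP (y i \in D)) => // /set_mem/DD' /mem_set ->.
Qed.

Lemma block_mean_swapn D i j k y : (i < 4 ^ k)%N -> (j < 4 ^ k)%N ->
  block_mean D k (fun n => y (swapn i j n)) = block_mean D k y.
Proof.
move=> ik jk; congr (_ / _); apply: eq_big_nat => n /andP[kn _].
by rewrite /swapn !gtn_eqF//; exact: leq_trans kn.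
Qed.

Lemma block_mean_bounded D y : bounded_fun (block_mean D ^~ y).
Proof.
exists 1; split => // x x1 k _ /=; apply: le_trans (ltW x1).
by have /andP[? ?] := block_mean_itv D k y; rewrite ger0_norm.
Qed.

Lemma measurable_indic_coord D i : measurable D ->
  measurable_fun setT (fun y : seq_space S => \1_D (y i) : R).
Proof.
move=> mD; apply: (measurableT_comp _ (@measurable_coord _ S i)).
exact: measurable_indic.
Qed.

Lemma measurable_block_mean D k : measurable D ->
  measurable_fun setT (block_mean D k).
Proof.
move=> mD; apply: measurable_funM; last exact: measurable_cst.
by apply: measurable_sum => i; exact: measurable_indic_coord.
Qed.

Lemma frequency_itv D y : 0 <= frequency D y <= 1.
Proof.
have b0 : bounded_fun (fun _ : nat => 0 : R).
  by exists 1; split => // x x1 k _ /=; rewrite normr0; lra.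
have b1 : bounded_fun (fun _ : nat => 1 : R).
  by exists 1; split => // x x1 k _ /=; rewrite normr1; lra.
have lc (c : R) : limn_sup (fun=> c) = c.
  by apply: (cvg_limn_inf_sup _).2; exact: cvg_cst.
apply/andP; split.
  rewrite -[leLHS]lc; apply: (@le_limn_sup _ _ _ 0) => //.
    exact: block_mean_bounded.
  by move=> k _; have /andP[] := block_mean_itv D k y.
rewrite -[leRHS]lc; apply: (@le_limn_sup _ _ _ 0) => //.
  exact: block_mean_bounded.
by move=> k _; have /andP[] := block_mean_itv D k y.
Qed.

Lemma le_frequency D D' y : D `<=` D' -> frequency D y <= frequency D' y.
Proof.
by move=> DD'; apply: (@le_limn_sup _ _ _ 0) => [||k _];
  [exact: block_mean_bounded|exact: block_mean_bounded|exact: le_block_mean].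
Qed.

Lemma frequencyT y : frequency setT y = 1.
Proof.
rewrite /frequency (_ : _ ^~ y = fun=> 1).
  by apply: (cvg_limn_inf_sup _).2; exact: cvg_cst.
by apply/funext => k; exact: block_meanT.
Qed.

Lemma frequency_swapn D i j y :
  frequency D (fun n => y (swapn i j n)) = frequency D y.
Proof.
have lt4 n k : (n <= k)%N -> (n < 4 ^ k)%N.
  by move=> nk; apply: leq_ltn_trans nk _; exact: ltn_expl.
have E k : (maxn i j <= k)%N ->
    block_mean D k (fun n => y (swapn i j n)) = block_mean D k y.
  by rewrite geq_max => /andP[? ?]; apply: block_mean_swapn; exact: lt4.
apply/eqP; rewrite eq_le; apply/andP; split;
  apply: (@le_limn_sup _ _ _ (maxn i j)); do ?exact: block_mean_bounded;
  by move=> k /E ->.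
Qed.

Lemma measurable_frequency D : measurable D -> measurable_fun setT (frequency D).
Proof.
move=> mD; apply: measurable_fun_limn_sup.
- by move=> y _; exact/bounded_fun_has_ubound/block_mean_bounded.
- by move=> y _; exact/bounded_fun_has_lbound/block_mean_bounded.
- by move=> k; exact: measurable_block_mean.
Qed.

End frequency.

Section exchangeable_law.
Context (R : realType) d (S : measurableType d).
Variable mu : probability (seq_space S) R.
Hypothesis mu_swap : forall i j (B : set (seq_space S)), measurable B ->
  mu [set y | B (fun n => y (swapn i j n))] = mu B.
Implicit Types (D : set S) (y : seq_space S) (k : nat).
Local Notation block_mean := (@block_mean R d S).
Local Notation block_weight := (@block_weight R).
Local Notation frequency := (@frequency R d S).

Let pair_set D i j : set (seq_space S) := [set y | D (y i) /\ D (y j)].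

Let measurable_pair_set D i j : measurable D -> measurable (pair_set D i j).
Proof.
move=> mD; apply: measurableI.
- by rewrite -[X in measurable X]setTI; exact: measurable_coord.
- by rewrite -[X in measurable X]setTI; exact: measurable_coord.
Qed.

(** A product of two transpositions moves a pair of distinct indices to [0] and
    [1]. *)
Lemma pair_prob D i j : measurable D ->
  mu (pair_set D i j) = if i == j then mu (pair_set D 0 0) else mu (pair_set D 0 1).
Proof.
move=> mD.
have sw a b i' j' :
    mu (pair_set D (swapn a b i') (swapn a b j')) = mu (pair_set D i' j').
  by rewrite -(mu_swap a b (measurable_pair_set i' j' mD)).
rewrite -(sw 0%N i) [swapn 0 i i](_ : _ = 0%N); last first.
  by rewrite /swapn eqxx; case: eqP.
have [<-|ij] := eqVneq i j; first by rewrite /swapn eqxx; case: eqP => [->|].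
set j' := swapn 0 i j.
have j'0 : j' != 0%N.
  by rewrite -[0%N](_ : swapn 0 i i = _) ?(inj_eq (inv_inj (@swapnK 0 i))) 1?eq_sym//
     /swapn eqxx; case: eqP.
rewrite -(sw 1%N j') [swapn 1 j' j'](_ : _ = 1%N); last first.
  by rewrite /swapn eqxx; case: eqP.
by rewrite /swapn /= eq_sym (negPf j'0).
Qed.

(** Off the diagonal all the second moments are equal, hence cancel since the
    weights sum to zero; the diagonal exceeds them by at most one. *)
Lemma weighted_sum_sqr D (c : nat -> R) M : measurable D ->
  \sum_(i < M) c i = 0 ->
  (\int[mu]_y ((\sum_(i < M) c i * \1_D (y i)) ^+ 2)%:E <=
   (\sum_(i < M) c i ^+ 2)%:E)%E.
Proof.
move=> mD c0.
pose p := fine (mu (pair_set D 0 0)); pose q := fine (mu (pair_set D 0 1)).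
have fin i j : mu (pair_set D i j) \is a fin_num.
  by apply: fin_num_measure; exact: measurable_pair_set.
have pq1 : p - q <= 1.
  have p1 : p <= 1.
    rewrite -[leRHS]/(fine 1%:E) fine_le//.
    by apply: probability_le1; exact: measurable_pair_set.
  have q0 : 0 <= q by rewrite fine_ge0.
  by lra.
have E y : ((\sum_(i < M) c i * \1_D (y i)) ^+ 2)%:E =
    (\sum_(ij : 'I_M * 'I_M)
      (c ij.1 * c ij.2)%:E * (\1_(pair_set D ij.1 ij.2) y)%:E)%E.
  rewrite expr2 big_distrlr/= pair_big/= -sumEFin; apply: eq_bigr => -[i j] _ /=.
  rewrite -EFinM; congr EFin; rewrite mulrACA; congr (_ * _).
  rewrite !indicE -natrM mulnb; congr (nat_of_bool _)%:R.
  apply/idP/idP => [/andP[/set_mem Di /set_mem Dj]|/set_mem[Di Dj]].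
    exact: mem_set.
  by rewrite !mem_set.
under eq_integral do rewrite E.
rewrite integral_sum//; last first.
  move=> [i j] /=; apply: integrableZl => //.
  apply: integrable_indic => //; exact: measurable_pair_set.
rewrite (eq_bigr (fun ij : 'I_M * 'I_M =>
    (c ij.1 * c ij.2 * (q + (p - q) * (ij.1 == ij.2)%:R))%:E)); last first.
  move=> [i j] _ /=; rewrite integralZl//; last first.
    apply: integrable_indic => //; exact: measurable_pair_set.
  rewrite integral_indic//; last exact: measurable_pair_set.
  rewrite setIT [in RHS]EFinM; congr (_ * _)%E; apply: (etrans (pair_prob i j mD)).
  rewrite -val_eqE/=; case: eqP => _ /=; rewrite -[LHS]fineK// -/p -/q; congr EFin; lra.
rewrite sumEFin lee_fin -(pair_big predT predT
  (fun i j : 'I_M => c i * c j * (q + (p - q) * (i == j)%:R)))/=.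
have -> : \sum_(i < M) \sum_(j < M) c i * c j * (q + (p - q) * (i == j)%:R) =
    (p - q) * \sum_(i < M) c i ^+ 2.
  rewrite mulr_sumr; apply: eq_bigr => i _.
  rewrite (eq_bigr (fun j : 'I_M =>
      c i * q * c j + (p - q) * c i * (c j * (i == j)%:R))); last first.
    by move=> j _; ring.
  rewrite big_split/= -!mulr_sumr c0 mulr0 add0r.
  rewrite (bigD1 i)//= eqxx mulr1 big1 ?addr0; first by rewrite expr2; ring.
  by move=> j ji; rewrite eq_sym (negPf ji) mulr0.
by rewrite ler_piMl// sumr_ge0// => i _; rewrite sqr_ge0.
Qed.

Lemma block_mean_increment_sqr D k : measurable D ->
  (\int[mu]_y ((block_mean D k.+1 y - block_mean D k y) ^+ 2)%:E <=
   (2 / (4 ^ k)%:R)%:E)%E.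
Proof.
move=> mD; pose M := (2 * 4 ^ k.+1)%N.
have kM : (2 * 4 ^ k <= M)%N by rewrite leq_mul// leq_exp2l.
pose c i := block_weight k.+1 i - block_weight k i.
have E y : block_mean D k.+1 y - block_mean D k y = \sum_(i < M) c i * \1_D (y i).
  rewrite (block_meanE _ _ _ (leqnn _)) (block_meanE _ _ _ kM) -sumrB.
  by apply: eq_bigr => i _; rewrite mulrBl.
under eq_integral do rewrite E.
apply: le_trans (weighted_sum_sqr mD _) _.
  by rewrite sumrB !sum_block_weight// subrr.
have w2 l : (2 * 4 ^ l <= M)%N -> \sum_(i < M) block_weight l i ^+ 2 = (4 ^ l)%:R^-1.
  move=> lM; rewrite (eq_bigr (fun i : 'I_M => (4 ^ l)%:R^-1 * block_weight l i)).
    by rewrite -mulr_sumr sum_block_weight// mulr1.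
  by move=> i _; rewrite /block_weight; case: ifP => _; rewrite ?expr0n ?mulr0// expr2.
rewrite lee_fin; apply: (@le_trans _ _
    (\sum_(i < M) (block_weight k.+1 i ^+ 2 + block_weight k i ^+ 2))).
  apply: ler_sum => i _; have w0 l : 0 <= block_weight l i.
    by rewrite /block_weight; case: ifP.
  by have := mulr_ge0 (w0 k) (w0 k.+1); rewrite /c; nra.
rewrite big_split/= !w2// expnS natrM invfM.
have : 0 <= (4 ^ k)%:R^-1 :> R by [].
by lra.
Qed.

(** The first moment is controlled by the second one through
    [|x| <= 1 / (2 e) + (e / 2) x^2], where [e = 2^k] balances the two terms. *)
Lemma block_mean_increment_norm D k : measurable D ->
  (\int[mu]_y (`|block_mean D k.+1 y - block_mean D k y|)%:E <=
   (3 / (2 ^ (k + 1))%:R)%:E)%E.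
Proof.
move=> mD.
pose e : R := (2 ^ k)%:R; have e0 : 0 < e by rewrite ltr0n expn_gt0.
have mdk : measurable_fun setT (fun y => block_mean D k.+1 y - block_mean D k y).
  by apply: measurable_funB; exact: measurable_block_mean.
have msq : measurable_fun setT
    (fun y => ((block_mean D k.+1 y - block_mean D k y) ^+ 2)%:E).
  by apply/measurable_EFinP; exact: measurable_funX.
apply: (@le_trans _ _ (\int[mu]_y ((2 * e)^-1%:E +
    (e / 2)%:E * ((block_mean D k.+1 y - block_mean D k y) ^+ 2)%:E))%E).
  apply: ge0_le_integral => //.
  - by apply/measurable_EFinP; exact: measurableT_comp.
  - by apply: emeasurable_funD => //; apply: measurable_funeM.
  - move=> y _; rewrite -EFinM -EFinD lee_fin; set x := _ - _.
    rewrite -[x ^+ 2]real_normK ?num_real//; set z := `|x|.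
    have : 0 <= (2 * e)^-1 * (1 - e * z) ^+ 2.
      by rewrite mulr_ge0 ?sqr_ge0// invr_ge0 mulr_ge0// ltW.
    rewrite (_ : _ * _ = (2 * e)^-1 + e / 2 * z ^+ 2 - z) ?subr_ge0//.
    by field; rewrite gt_eqF.
have e20 : (0 <= (e / 2)%:E)%E by rewrite lee_fin divr_ge0// ltW.
rewrite ge0_integralD//; last 3 first.
- by move=> y _; rewrite lee_fin invr_ge0 mulr_ge0// ltW.
- by move=> y _; rewrite mule_ge0// lee_fin sqr_ge0.
- by apply: measurable_funeM.
rewrite integral_cst//= probability_setT mule1 ge0_integralZl//; last first.
  by move=> y _; rewrite lee_fin sqr_ge0.
apply: (@le_trans _ _ ((2 * e)^-1%:E + (e / 2)%:E * (2 / (4 ^ k)%:R)%:E)%E).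
  by rewrite leeD2l// lee_wpmul2l// block_mean_increment_sqr.
rewrite -EFinM -EFinD lee_fin.
have -> : (4 ^ k)%:R = e * e :> R by rewrite -natrM -expnMn.
rewrite addn1 expnS natrM -/e.
rewrite (_ : _ + _ = 3 / (2 * e))//; field.
by rewrite gt_eqF.
Qed.


(** The increments are summable in mean, hence almost surely. *)
Lemma block_mean_cvg D : measurable D ->
  {ae mu, forall y, block_mean D ^~ y @ \oo --> frequency D y}.
Proof.
move=> mD.
pose f k y : \bar R := (`|block_mean D k.+1 y - block_mean D k y|)%:E.
have mf k : measurable_fun setT (f k).
  apply/measurable_EFinP; apply: measurableT_comp => //.
  by apply: measurable_funB; exact: measurable_block_mean.
have f0 k y : (0 <= f k y)%E by rewrite lee_fin.
have int_f : mu.-integrable setT (fun y => \sum_(k <oo) f k y)%E.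
  apply/integrableP; split; first exact: ge0_emeasurable_sum.
  under eq_integral do rewrite gee0_abs ?nneseries_ge0//.
  rewrite integral_nneseries//; apply: (@le_lt_trans _ _ 3%:E); last exact: ltry.
  rewrite -[leRHS](_ : limn (eseries (fun k => (3 / (2 ^ (k + 1))%:R)%:E : \bar R)) = _).
    apply: lee_nneseries => [k _ _|k _]; first exact: integral_ge0.
    exact: block_mean_increment_norm.
  apply/cvg_lim => //; have := @cvg_geometric_eseries_half R 3 0.
    by rewrite expr0 divr1; exact.
have := integrable_ae measurableT int_f.
apply: filterS => y /(_ I) fin_y.
pose u := block_mean D ^~ y.
pose v n := `|telescope u n|.
have cv : cvgn (series v).
  apply: nondecreasing_is_cvgn.
    by apply/nondecreasing_seqP => n; rewrite seriesSr lerDl normr_ge0.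
  exists (fine (\sum_(k <oo) f k y)) => _ [n _ <-].
  rewrite -lee_fin fineK// seriesEnat/= -sumEFin.
  by apply: (nneseries_lim_ge (u_ := f ^~ y)).
have tel : cvgn (series (telescope u)) by exact: normed_cvg cv.
have cu : cvgn u.
  rewrite (_ : u = fun n => u 0%N + series (telescope u) n); last first.
    by apply/funext => n; exact: eq_sum_telescope.
  by apply: is_cvgD => //; exact: is_cvg_cst.
by rewrite /frequency (cvg_limn_supE cu).
Qed.

Lemma integral_swap i j (f : seq_space S -> \bar R) :
  measurable_fun setT f -> (forall y, 0 <= f y)%E ->
  (\int[mu]_y f (fun n => y (swapn i j n)) = \int[mu]_y f y)%E.
Proof.
move=> mf f0; have mphi := @measurable_reindex _ S (swapn i j).
rewrite -(ge0_integral_pushforward mphi mu measurableT mf)//.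
by apply: eq_measure_integral => B mB _; exact: mu_swap.
Qed.

(** For [H] all coordinates from [j] on are alike, so [y j] can be replaced
    by any later coordinate, then by the average over a far block, and in
    the limit by the frequency. *)
Lemma integral_indic_frequency D j (H : seq_space S -> R) :
  measurable D -> measurable_fun setT H -> (forall y, 0 <= H y <= 1) ->
  (forall i y, (j < i)%N -> H (fun n => y (swapn j i n)) = H y) ->
  (\int[mu]_y (H y * \1_D (y j))%:E = \int[mu]_y (H y * frequency D y)%:E)%E.
Proof.
move=> mD mH H01 Hs.
have H0 y : 0 <= H y by have /andP[] := H01 y.
have mHi i : measurable_fun setT (fun y : seq_space S => (H y * \1_D (y i))%:E).
  by apply/measurable_EFinP; apply: measurable_funM => //; exact: measurable_indic_coord.
have Hi i : (j < i)%N ->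
    (\int[mu]_y (H y * \1_D (y i))%:E = \int[mu]_y (H y * \1_D (y j))%:E)%E.
  move=> ji; rewrite -(integral_swap j i (mHi i)) => [|y]; last first.
    by rewrite lee_fin mulr_ge0.
  apply: eq_integral => y _; rewrite Hs//; congr (_ * \1_D (y _))%:E.
  by rewrite /swapn eqxx; case: eqP.
have v_fin : (\int[mu]_y (H y * \1_D (y j))%:E)%E \is a fin_num.
  rewrite ge0_fin_numE; last by apply: integral_ge0 => y _; rewrite lee_fin mulr_ge0.
  apply: (@le_lt_trans _ _ (\int[mu]_y cst 1%E y)%E).
    apply: ge0_le_integral => // y _; first by rewrite lee_fin mulr_ge0.
    by rewrite lee_fin mulr_ile1//; have /andP[] := H01 y.
  by rewrite integral_cst//= probability_setT mule1 ltry.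
have Hk k : (j < 4 ^ k)%N ->
    (\int[mu]_y (H y * block_mean D k y)%:E = \int[mu]_y (H y * \1_D (y j))%:E)%E.
  move=> jk.
  have E y : (H y * block_mean D k y)%:E =
     (((4 ^ k)%:R^-1)%:E * \sum_(4 ^ k <= i < 2 * 4 ^ k) (H y * \1_D (y i))%:E)%E.
    by rewrite sumEFin -EFinM -mulr_sumr /block_mean; congr EFin; ring.
  under eq_integral do rewrite E.
  rewrite ge0_integralZl//; last 2 first.
  - by apply: emeasurable_sum.
  - by move=> y _; apply: sume_ge0 => i _; rewrite lee_fin mulr_ge0.
  rewrite ge0_integral_sum//; last by move=> i y _; rewrite lee_fin mulr_ge0.
  rewrite big_nat (eq_bigr (fun=> \int[mu]_y (H y * \1_D (y j))%:E)%E); last first.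
    by move=> i /andP[ki _]; apply: Hi; exact: leq_trans ki.
  rewrite -big_nat -[in LHS](fineK v_fin) sumEFin sumr_const_nat mul2n -addnn addnK.
  rewrite -EFinM -[X in _ * X]mulr_natl mulKf ?fineK//.
have : (\int[mu]_y (H y * block_mean D k y)%:E)%E @[k --> \oo] -->
    (\int[mu]_y (H y * frequency D y)%:E)%E.
  have mHf (g : seq_space S -> R) : measurable_fun setT g ->
      measurable_fun setT (fun y => (H y * g y)%:E).
    by move=> mg; apply/measurable_EFinP; exact: measurable_funM.
  have [|||||_ _] := @dominated_convergence _ _ _ mu setT measurableT
    (fun k y => (H y * block_mean D k y)%:E)
    (fun y => (H y * frequency D y)%:E) (cst 1%E).
  - by move=> k; apply: mHf; exact: measurable_block_mean.
  - by apply: mHf; exact: measurable_frequency.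
  - apply: filterS (block_mean_cvg mD) => y cy _.
    apply: cvg_EFin; first by apply: nearW.
    by apply: cvgM; [exact: cvg_cst|exact: cy].
  - exact: finite_measure_integrable_cst.
  - apply: aeW => y k _; have /andP[b0 b1] := block_mean_itv R D k y.
    rewrite lee_fin ger0_norm; last exact: mulr_ge0.
    by apply: mulr_ile1 => //; have /andP[] := H01 y.
  by apply.
move=> /cvg_lim <- //; apply/esym/cvg_lim => //.
apply: cvg_near_cst; exists j => // k /= jk; apply: Hk.
by apply: leq_ltn_trans jk _; exact: ltn_expl.
Qed.

(** De Finetti's identity: given the limiting frequencies, the coordinates
    behave like independent draws from them. The indicators are traded for
    frequencies one coordinate at a time; when the turn of coordinate [j]
    comes, the other factors involve coordinates below [j] and frequencies,
    so none of them is affected by exchanging [j] with a later index. *)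
Lemma integral_prod_frequency N (D : nat -> set S) : (forall n, measurable (D n)) ->
  (\int[mu]_y (\prod_(n < N) frequency (D n) y)%:E =
   mu [set y | forall n, (n < N)%N -> D n (y n)])%E.
Proof.
move=> mD.
pose g j n y : R := if (n < j)%N then \1_(D n) (y n) else frequency (D n) y.
have g01 j n y : 0 <= g j n y <= 1.
  rewrite /g; case: ifP => _; last exact: frequency_itv.
  by rewrite indicE ler0n lern1 leq_b1.
have mg j n : measurable_fun setT (g j n).
  rewrite /g; case: (n < j)%N; first exact: measurable_indic_coord.
  exact: measurable_frequency.
have step j : (j < N)%N ->
    (\int[mu]_y (\prod_(n < N) g j n y)%:E =
     \int[mu]_y (\prod_(n < N) g j.+1 n y)%:E)%E.
  move=> jN; pose j0 := Ordinal jN.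
  pose H y := \prod_(n < N | n != j0) g j n y.
  have E y : \prod_(n < N) g j n y = H y * frequency (D j) y.
    by rewrite (bigD1 j0)//= mulrC /g ltnn.
  have E' y : \prod_(n < N) g j.+1 n y = H y * \1_(D j) (y j).
    rewrite (bigD1 j0)//= mulrC {2}/g ltnSn; congr (_ * _).
    apply: eq_bigr => n; rewrite -val_eqE/= => nj.
    by rewrite /g ltnS leq_eqVlt (negPf nj).
  under eq_integral do rewrite E.
  under [RHS]eq_integral do rewrite E'.
  apply/esym; apply: integral_indic_frequency => //.
  - rewrite (_ : H = fun y => \prod_(n < N) (if n != j0 then g j n y else 1)).
      by apply: measurable_prod => n _; case: (n != j0).
    by apply/funext => y; rewrite /H big_mkcond.
  - move=> y; rewrite /H prodr_ge0/=; last by move=> n _; have /andP[] := g01 j n y.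
    apply: (@le_trans _ _ (\prod_(n < N | n != j0) 1)); last by rewrite big1.
    by apply: ler_prod => n _; exact: g01.
  - move=> i y ji; apply: eq_bigr => n; rewrite -val_eqE/= => nj.
    rewrite /g frequency_swapn; case: ifP => // nlj.
    by rewrite /swapn (negPf nj) ltn_eqF// (ltn_trans nlj).
have steps j : (j <= N)%N ->
    (\int[mu]_y (\prod_(n < N) frequency (D n) y)%:E =
     \int[mu]_y (\prod_(n < N) g j n y)%:E)%E.
  elim: j => [_|j IH jN]; first by apply: eq_integral => y _; congr EFin; apply: eq_bigr.
  by rewrite -step// IH// ltnW.
rewrite (steps N)//.
pose C : set (seq_space S) := [set y | forall n, (n < N)%N -> D n (y n)].
have mC : measurable C.
  apply: (@cylinder_measurable _ _ (seq_space S) S (fun n y => y n)) => //.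
  by move=> n; exact: measurable_coord.
transitivity (\int[mu]_y (\1_C y)%:E)%E; last by rewrite integral_indic// setIT.
apply: eq_integral => y _; congr EFin; rewrite indicE.
rewrite (eq_bigr (fun n : 'I_N => \1_(D n) (y n))); last first.
  by move=> n _; rewrite /g ltn_ord.
have [/set_mem/= yD|/negP yD] := boolP (y \in _).
  by rewrite big1// => n _; rewrite indicE mem_set//; exact: yD.
have [n nD] : exists n : 'I_N, ~ D n (y n).
  apply/existsNP => yD'; apply: yD; apply/mem_set => n nN.
  exact: (yD' (Ordinal nN)).
by rewrite (bigD1 n)//= indicE memNset ?mul0r.
Qed.

End exchangeable_law.

(** * From limiting frequencies to a talent model *)

Lemma lt_le_subV (R : realType) (a x : R) :
  a < x <-> exists k, a <= x - k.+1%:R^-1.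
Proof.
split=> [ax|[k /le_lt_trans]]; last by apply; rewrite ltrBlDr ltrDl.
exists (Num.truncn (x - a)^-1).
rewrite lerBrDr addrC -lerBrDr -[leRHS]invrK lef_pV2 ?posrE ?invr_gt0 ?subr_gt0//.
by rewrite ltW// truncnS_gt.
Qed.

Section quantile.
Context (R : realType) d (S : measurableType d) (phi : S -> R).
Hypothesis mphi : measurable_fun setT phi.
Implicit Types (y : seq_space S) (u : measurableTypeR R).
Local Notation frequency := (@frequency R d S).

Definition sublevel (x : R) : set S := [set s | phi s <= x].

Lemma measurable_sublevel x : measurable (sublevel x).
Proof.
rewrite (_ : sublevel x = phi @^-1` `]-oo, x]%classic).
  by rewrite -[X in measurable X]setTI; exact: mphi.
by apply/seteqP; split => s; rewrite /preimage/= in_itv/=.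
Qed.

Lemma le_sublevel x x' : x <= x' -> sublevel x `<=` sublevel x'.
Proof. by move=> xx' s /= sx; exact: le_trans xx'. Qed.

(** The generalized inverse of the limiting empirical distribution function,
    restricted to rational levels so that it is measurable in both
    arguments. It is infinite when the levels reached are unbounded below or
    when there are none. *)
Definition quantile (z : seq_space S * measurableTypeR R) : \bar R :=
  ereal_inf [set (ratr q : R)%:E | q in
    [set q : rat | z.2 < frequency (sublevel (ratr q)) z.1]].

Lemma quantile_lt z (x : R) : (quantile z < x%:E)%E <->
  exists q : rat, ratr q < x /\ z.2 < frequency (sublevel (ratr q)) z.1.
Proof.
split=> [/ereal_inf_lt[_ [q /= zq <-]]|[q [qx zq]]].
  by rewrite lte_fin => qx; exists q.
apply: le_lt_trans (_ : _ <= (ratr q)%:E)%E _; last by rewrite lte_fin.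
by apply: ereal_inf_lbound; exists q.
Qed.

Lemma measurable_lt_frequency (D : set S) : measurable D ->
  measurable [set z : seq_space S * measurableTypeR R | z.2 < frequency D z.1].
Proof.
move=> mD.
have mf : measurable_fun setT
    (fun z : seq_space S * measurableTypeR R => z.2 < frequency D z.1).
  apply: measurable_fun_ltr; first exact: measurable_snd.
  exact: (measurableT_comp (measurable_frequency mD) measurable_fst).
by have := mf measurableT [set true] I; rewrite setTI.
Qed.

Lemma measurable_quantile : measurable_fun setT quantile.
Proof.
apply: (measurability _ (ErealGenInftyO.measurableE R)) => _ /= -[_ [x ->] <-].
rewrite setTI (_ : _ @^-1` _ = \bigcup_(q : rat)
  (if (ratr q : R) < x
   then [set z | z.2 < frequency (sublevel (ratr q)) z.1] else set0)).
  apply: bigcupT_measurable_rat => q; case: ifP => // _.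
  by apply: measurable_lt_frequency; exact: measurable_sublevel.
apply/seteqP; split => z; rewrite /preimage/= in_itv/=.
  by move=> /quantile_lt[q [qx zq]]; exists q => //; rewrite qx.
by move=> [q _]; case: ifP => // qx zq; apply/quantile_lt; exists q.
Qed.

(** A limiting frequency is finitely but not countably additive, so the
    frequency of [sublevel x] says nothing about the levels just below [x]:
    the event is expressed through the levels [x - 1/(k+1)] themselves. *)
Lemma quantile_ltE z (x : R) : (quantile z < x%:E)%E <->
  exists k, z.2 < frequency (sublevel (x - k.+1%:R^-1)) z.1.
Proof.
split=> [/quantile_lt[q [qx zq]]|[k zk]].
  have /lt_le_subV[k qk] := qx.
  by exists k; apply: lt_le_trans zq _; exact/le_frequency/le_sublevel.
have kx : x - k.+1%:R^-1 < x by rewrite ltrBlDr ltrDl.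
have [q] := rat_in_itvoo kx.
rewrite in_itv/= => /andP[kq qx]; apply/quantile_lt; exists q; split => //.
by apply: lt_le_trans zk _; apply/le_frequency/le_sublevel/ltW.
Qed.

End quantile.

Section retract.
Context (R : realType) d (S : measurableType d) (phi : S -> R).
Hypothesis phi_inj : injective phi.
Hypothesis phi_image : forall A : set S, measurable A -> measurable (phi @` A).

(** A measurable left inverse of the embedding of the states in the line;
    the default value off the range makes it total. *)
Definition retract (e : \bar R) : S :=
  if pselect (exists s, (phi s)%:E = e) is left h then projT1 (cid h) else point.

Lemma retractK s : retract (phi s)%:E = s.
Proof.
rewrite /retract; case: pselect => [h|[]]; last by exists s.
by case: cid => t /= [/phi_inj].
Qed.

Lemma measurable_retract : measurable_fun setT retract.
Proof.
have mE (A : set S) : measurable A -> measurable (EFin @` (phi @` A)).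
  by move=> mA; apply: measurable_image_EFin; exact: phi_image.
move=> _ A mA; rewrite setTI.
rewrite (_ : _ @^-1` _ = EFin @` (phi @` A) `|`
    (if pselect (A point) then ~` (EFin @` (phi @` setT)) else set0)); last first.
  apply/seteqP; split => e /=.
    rewrite /retract; case: pselect => [h|h] Ae.
      by left; case: cid Ae => s se /= As; exists (phi s) => //; exists s.
    right; case: pselect => // _ -[_ [s _ <-] se]; apply: h; by exists s.
  move=> [[_ [s As <-] <-]|]; first by rewrite retractK.
  case: pselect => // Ap h; rewrite /retract; case: pselect => // -[s se].
  by exfalso; apply: h; exists (phi s) => //; exists s.
apply: measurableU; first exact: mE.
by case: pselect => ? //=; apply: measurableC; exact: mE.
Qed.

End retract.

Section construction.
Context (R : realType) d (S : measurableType d).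
Variable mu : probability (seq_space S) R.
Local Notation unif := (@unif R).
Local Notation frequency := (@frequency R d S).
Local Notation sample_space := (seq_space S * measurableTypeR R)%type.

(** The talent is a path of law [mu]; one independent uniform number carries the
    whole sequence of chance components. *)
Definition sample_prob : probability sample_space R := (mu \x unif)%E.

Definition talent (z : sample_space) : seq_space S := z.1.
HB.instance Definition _ := isMeasurableFun.Build _ _
  sample_space (seq_space S) talent measurable_fst.

Definition luck n (z : sample_space) : measurableTypeR R := unif_seq n z.2.

Lemma measurable_luck n : measurable_fun setT (luck n).
Proof. exact: (measurableT_comp (@measurable_unif_seq R n) measurable_snd). Qed.

HB.instance Definition _ n := isMeasurableFun.Build _ _
  sample_space (measurableTypeR R) (luck n) (measurable_luck n).

Lemma sample_prob_luck (A : set (measurableTypeR R)) : measurable A ->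
  sample_prob [set z | A z.2] = unif A.
Proof.
move=> mA; rewrite (_ : mkset _ = setT `*` A); last by apply/seteqP; split => z //= [].
apply: (etrans (product_measure1E mu unif measurableT mA)); rewrite -[RHS]mul1e.
by congr (_ * _)%E; exact: probability_setT.
Qed.

Lemma luck_law n (A : set (measurableTypeR R)) : measurable A ->
  sample_prob (luck n @^-1` A) = unif A.
Proof.
move=> mA; rewrite -(unif_seq_law n mA).
apply: (sample_prob_luck (A := unif_seq n @^-1` A)).
by rewrite -[X in measurable X]setTI; exact: measurable_unif_seq.
Qed.

Lemma luck_indep : mutually_independent (P := sample_prob)
  (fun n => luck n : {RV sample_prob >-> measurableTypeR R}).
Proof.
move=> J B mB.
pose C (n : nat) := if n \in J then B n else setT.
have mC n : measurable (C n) by rewrite /C; case: ifP.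
pose N := (\max_(n <- J) n).+1.
have JN n : n \in J -> (n < N)%N by move=> nJ; rewrite ltnS; exact: leq_bigmax_seq.
rewrite (_ : \bigcap_(n in _) _ =
    [set z | [set u | forall n, (n < N)%N -> C n (unif_seq n u)] z.2]); last first.
  apply/seteqP; split=> z /= zB n.
    by rewrite /C => _; case: ifP => // nJ; exact: (zB n nJ).
  by move=> /= nJ; have := zB n (JN n nJ); rewrite /C nJ.
rewrite (sample_prob_luck (@cylinder_measurable _ _ _ _ (@unif_seq R) N C
  (@measurable_unif_seq R) mC)).
rewrite unif_seq_indep// -(big_mkord xpredT (fun n => unif (C n))).
rewrite (bigID (mem J))/= [X in (_ * X)%E]big1 ?mule1; last first.
  by move=> n /negPf nJ; rewrite /C nJ/= probability_setT.
have PE : perm_eq [seq n <- index_iota 0 N | n \in J] J.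
  apply: uniq_perm; rewrite ?filter_uniq ?iota_uniq ?fset_uniq// => n.
  rewrite mem_filter mem_index_iota/=.
  by case: (boolP (n \in J)) => //= /JN.
rewrite -big_filter (perm_big _ PE)/=.
rewrite [LHS]big_seq [RHS]big_seq; apply: eq_bigr => n nJ.
by rewrite /C nJ; apply/esym/luck_law.
Qed.

Lemma luck_identical : identically_distributed (P := sample_prob)
  (fun n => luck n : {RV sample_prob >-> measurableTypeR R}).
Proof.
by move=> m n B mB; apply: (etrans (luck_law m mB)); exact/esym/luck_law.
Qed.

Lemma talent_indep : independent_of_sequence (P := sample_prob)
  (talent : {RV sample_prob >-> seq_space S})
  (fun n => luck n : {RV sample_prob >-> measurableTypeR R}).
Proof.
move=> A B mA mB.
pose B' : set (measurableTypeR R) := [set u | B (fun n => unif_seq n u)].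
have mB' : measurable B'.
  have mseq : measurable_fun setT
      (fun u : measurableTypeR R =>
        (fun n => unif_seq n u) : seq_space (measurableTypeR R)).
    by apply: measurable_seq => n; exact: measurable_unif_seq.
  by have := mseq measurableT B mB; rewrite setTI.
have -> : sample_prob ((fun w n => luck n w) @^-1` B) = unif B'.
  exact: (sample_prob_luck mB').
have -> : sample_prob (talent @^-1` A) = mu A.
  rewrite (_ : _ @^-1` _ = A `*` setT); last by apply/seteqP; split => z //= [].
  apply: (etrans (product_measure1E mu unif mA measurableT)); rewrite -[RHS]mule1.
  by congr (_ * _)%E; exact: probability_setT.
rewrite (_ : _ `&` _ = A `*` B'); last by apply/seteqP; split.
exact: (product_measure1E mu unif mA mB').
Qed.

Hypothesis mu_swap : forall i j (B : set (seq_space S)), measurable B ->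
  mu [set y | B (fun n => y (swapn i j n))] = mu B.

(** The event that a uniform number falls below the frequency of [D]. When
    [b] is [false] the coordinate is unconstrained: the event is then the
    whole space and not [u < 1], which differs from it by a null set. *)
Definition coin (b : bool) (D : set S) (y : seq_space S) :
    set (measurableTypeR R) :=
  if b then [set u | u < frequency D y] else setT.

Lemma measurable_coin b D : measurable D ->
  measurable [set z : sample_space | coin b D z.1 z.2].
Proof.
move=> mD; case: b; first exact: measurable_lt_frequency.
by rewrite (_ : mkset _ = setT).
Qed.

(** Given the path, the coins are independent with the frequencies as success
    probabilities; the path is then integrated out by de Finetti's identity. *)
Lemma sample_prob_coins N (b : nat -> bool) (D : nat -> set S) :
  (forall n, measurable (D n)) -> (forall n, b n = false -> D n = setT) ->
  sample_prob [set z | forall n, (n < N)%N -> coin (b n) (D n) z.1 (luck n z)] =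
  mu [set y | forall n, (n < N)%N -> D n (y n)].
Proof.
move=> mD bD; rewrite -(integral_prod_frequency mu_swap N mD).
rewrite /sample_prob/= /product_measure1; apply: eq_integral => y _.
have mc n : measurable (coin (b n) (D n) y).
  rewrite /coin; case: (b n) => //.
  rewrite (_ : mkset _ = `]-oo, frequency (D n) y[%classic) ?measurable_itv//.
transitivity
  (unif [set u | forall n, (n < N)%N -> coin (b n) (D n) y (unif_seq n u)]).
  by congr (unif _); apply/seteqP; split => u; rewrite /xsection/= inE.
rewrite (unif_seq_indep N mc) -prodEFin; apply: eq_bigr => n _.
rewrite /coin; case: ifP => [_|/bD ->]; last by rewrite probability_setT frequencyT.
rewrite -[[set u | _]]/(`]-oo, frequency (D n) y[%classic) unif_ray; congr EFin.
have /andP[f0 f1] := frequency_itv R (D n) y.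
by rewrite /clamp (max_r f0) (min_r f1).
Qed.

End construction.

Lemma exists_common_bound N (Q : nat -> nat -> Prop) :
  (forall n k k', (k <= k')%N -> Q n k -> Q n k') ->
  (forall n, (n < N)%N -> exists k, Q n k) <->
  exists k, forall n, (n < N)%N -> Q n k.
Proof.
move=> Qm; split=> [|[k kQ] n nN]; last by exists k; exact: kQ.
elim: N => [|N IH] QN; first by exists 0%N.
have [k kQ] : exists k, forall n, (n < N)%N -> Q n k.
  by apply: IH => n nN; apply: QN; exact: ltnW.
have [k' k'Q] := QN N (ltnSn N).
exists (maxn k k') => n; rewrite ltnS leq_eqVlt => /orP[/eqP ->|nN].
  by apply: Qm k'Q; exact: leq_maxr.
by apply: Qm (kQ n nN); exact: leq_maxl.
Qed.

Section law_of_quantiles.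
Context (R : realType) d (S : measurableType d) (phi : S -> R).
Hypothesis mphi : measurable_fun setT phi.
Variable mu : probability (seq_space S) R.
Hypothesis mu_swap : forall i j (B : set (seq_space S)), measurable B ->
  mu [set y | B (fun n => y (swapn i j n))] = mu B.
Local Notation quantile := (@quantile R d S phi).
Local Notation sublevel := (sublevel phi).
Local Notation P := (sample_prob mu).

Definition lower_rays : set (set (\bar R)) :=
  [set A | exists b (x : R), A = if b then [set e | (e < x%:E)%E] else setT].

Lemma lower_rays_sigma : measurable = <<s lower_rays >>.
Proof.
rewrite [LHS](ErealGenInftyO.measurableE R); apply/seteqP; split.
  apply: smallest_sub; first exact: smallest_sigma_algebra.
  move=> _ [x ->]; apply: sub_sigma_algebra; exists true, x.
  by apply/seteqP; split => e /=; rewrite in_itv.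
apply: smallest_sub; first exact: smallest_sigma_algebra.
move=> _ [[] [x ->]]; last first.
  exact: (@measurableT _ (g_sigma_algebraType (@ErealGenInftyO.G R))).
apply: sub_sigma_algebra; exists x.
by apply/seteqP; split => e /=; rewrite in_itv.
Qed.

Lemma lower_rays_setI : setI_closed lower_rays.
Proof.
move=> _ _ [b1 [x1 ->]] [b2 [x2 ->]].
case: b1; last by rewrite setTI; exists b2, x2.
case: b2; last by rewrite setIT; exists true, x1.
exists true, (Num.min x1 x2); apply/seteqP; split => e /=.
  by rewrite EFin_min lt_min => -[-> ->].
by rewrite EFin_min lt_min => /andP[].
Qed.

(** Both cylinder events are increasing unions over [k] of events that only
    involve the closed levels [x - 1/(k+1)], and at each [k] the coins match
    the coordinates. *)
Lemma quantile_law :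
  same_joint_distribution P mu
    (fun n z => quantile (talent z, luck n z)) (fun n y => (phi (y n))%:E).
Proof.
have mq n : measurable_fun setT
    (fun z : seq_space S * measurableTypeR R => quantile (talent z, luck n z)).
  apply: (measurableT_comp (measurable_quantile mphi)).
  apply: measurable_fun_pair; first exact: measurable_fst.
  exact: measurable_luck.
have mp n : measurable_fun setT (fun y : seq_space S => (phi (y n))%:E).
  by apply/measurable_EFinP; apply: (measurableT_comp mphi); exact: measurable_coord.
apply: (eq_joint_distribution lower_rays_sigma lower_rays_setI) => //.
  by exists false, 0.
move=> N B GB.
have [b /choice[x BE]] := choice GB.
pose D k n := if b n then sublevel (x n - k.+1%:R^-1) else setT.
have mD k n : measurable (D k n).
  by rewrite /D; case: (b n) => //; exact: measurable_sublevel.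
have Dmono k k' n : (k <= k')%N -> D k n `<=` D k' n.
  move=> kk'; rewrite /D; case: (b n) => //; apply: le_sublevel.
  by rewrite lerD2l lerN2 lef_pV2 ?posrE// ler_nat.
have cmono k k' n y : (k <= k')%N ->
    coin (b n) (D k n) y `<=` coin (b n) (D k' n) y.
  move=> kk'; rewrite /coin; case: (b n) => //= u uk.
  by apply: lt_le_trans uk _; apply: le_frequency; exact: Dmono.
pose F k := [set z | forall n, (n < N)%N -> coin (b n) (D k n) z.1 (luck n z)]
  : set (seq_space S * measurableTypeR R).
pose E k := [set y | forall n, (n < N)%N -> D k n (y n)] : set (seq_space S).
have mE k : measurable (E k).
  apply: (@cylinder_measurable _ _ (seq_space S) S (fun n y => y n) N (D k)) => //.
  by move=> n; exact: measurable_coord.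
have mF k : measurable (F k).
  rewrite (_ : F k = \bigcap_(n < N) [set z | coin (b n) (D k n) z.1 (luck n z)]).
    apply: fin_bigcap_measurable; first exact: finite_II.
    move=> n _.
    have mz : measurable_fun setT
        (fun z : seq_space S * measurableTypeR R => (z.1, luck n z)).
      by apply: measurable_fun_pair; [exact: measurable_fst|exact: measurable_luck].
    by have := mz measurableT _ (measurable_coin (b n) (mD k n)); rewrite setTI.
  by apply/seteqP; split.
have FE : [set z | forall n, (n < N)%N ->
    B n (quantile (talent z, luck n z))] = \bigcup_k F k.
  apply/seteqP; split => z /=.
    move=> zB; have [] := (@exists_common_bound N
        (fun n k => coin (b n) (D k n) z.1 (luck n z)) _).1.
    - by move=> n k k' kk'; exact: cmono.
    - move=> n nN; have := zB n nN; rewrite BE /coin /D.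
      by case: (b n) => [/quantile_ltE[k zk]|_]; [by exists k|by exists 0%N].
    - by move=> k Fk; exists k.
  move=> [k _ Fk] n nN; have := Fk n nN; rewrite BE /coin /D.
  by case: (b n) => //= ck; apply/quantile_ltE; exists k.
have EE : [set y : seq_space S | forall n, (n < N)%N ->
    B n (phi (y n))%:E] = \bigcup_k E k.
  apply/seteqP; split => y /=.
    move=> yB; have [] := (@exists_common_bound N (fun n k => D k n (y n)) _).1.
    - by move=> n k k' kk'; exact: Dmono.
    - move=> n nN; have := yB n nN; rewrite BE /D.
      case: (b n) => [|_]; last by exists 0%N.
      by rewrite /= lte_fin => /lt_le_subV.
    - by move=> k Ek; exists k.
  move=> [k _ Ek] n nN; have := Ek n nN; rewrite BE /D.
  by case: (b n) => //= yk; rewrite lte_fin; apply/lt_le_subV; exists k.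
have Fcvg : P (F k) @[k --> \oo] --> P (\bigcup_k F k).
  apply: nondecreasing_cvg_mu => //; first exact: bigcupT_measurable.
  move=> k k' kk'; apply/subsetPset => z Fz n nN.
  by apply: cmono kk' _ (Fz n nN).
have Ecvg : mu (E k) @[k --> \oo] --> mu (\bigcup_k E k).
  apply: nondecreasing_cvg_mu => //; first exact: bigcupT_measurable.
  move=> k k' kk'; apply/subsetPset => y Ey n nN.
  by apply: Dmono kk' _ (Ey n nN).
have FkE k : P (F k) = mu (E k).
  by apply: sample_prob_coins => // n; rewrite /D => ->.
rewrite FE EE; move/cvg_lim : Fcvg => <- //; apply/cvg_lim => //.
by under eq_fun do rewrite FkE.
Qed.

End law_of_quantiles.

(** The law of the quantiles is identified on the extended line first, and
    only then transported by [retract], which is defined everywhere: the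
    quantiles need to lie in the range of [phi] only almost surely. *)
Lemma exchangeable_talent_model (R : realType) dS (S : measurableType dS)
    (hS : borel_space R S) dO (Om : measurableType dO) (P : probability Om R)
    (Y : nat -> {RV P >-> S}) :
  exchangeable P (fun n => Y n) ->
  exists M : talent_model R S,
    same_joint_distribution (tm_P M) P (tm_observation M) (fun n => Y n).
Proof.
move=> exY; have [phi [mphi phi_inj phi_image]] := hS.
pose mu : probability (seq_space S) R := distribution P (sample_path Y).
have mu_swap i j (B : set (seq_space S)) : measurable B ->
    mu [set y | B (fun n => y (swapn i j n))] = mu B.
  by move=> mB; rewrite [RHS](exY _ (swapn_finite_permutation i j) B mB).
pose f (z : seq_space S * measurableTypeR R) := retract phi (quantile phi z).
have mdec := measurable_retract phi_inj phi_image.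
have mf : measurable_fun setT f.
  by apply: (measurableT_comp mdec); exact: measurable_quantile.
pose fm : {mfun (seq_space S * measurableTypeR R)%type >-> S} :=
  HB.pack f (isMeasurableFun.Build _ _ _ _ f mf).
pose M : talent_model R S := @TalentModel R _ S _ _ (sample_prob mu) _ _ _ _
  (@talent R dS S : {RV sample_prob mu >-> seq_space S})
  (fun n => @luck R dS S n : {RV sample_prob mu >-> measurableTypeR R}) fm
  (luck_indep mu) (luck_identical mu) (talent_indep mu).
exists M => B mB.
pose Psi (e : seq_space (\bar R)) : seq_space S := fun n => retract phi (e n).
have mPsi : measurable_fun setT Psi.
  by apply: measurable_seq => n; apply: (measurableT_comp mdec); exact: measurable_coord.
have mB' : product_sigma_algebra (Psi @^-1` B).
  by rewrite -seq_space_measurable; have := mPsi measurableT B mB; rewrite setTI.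
apply: (etrans (quantile_law mphi mu_swap mB')).
rewrite /joint_distribution /mu /distribution /pushforward.
congr (P _); apply/seteqP; split => w; rewrite /preimage/= /Psi/sample_path.
  by under eq_fun do rewrite retractK//.
by under [X in B X -> _]eq_fun do rewrite -(retractK phi_inj (Y _ _)).
Qed.

Theorem theorem4 (R : realType)
    (dS : measure_display) (S : measurableType dS) (hS : borel_space R S)
    (dOmega : measure_display) (Omega : measurableType dOmega)
    (P : probability Omega R) (Y : nat -> {RV P >-> S}) :
  (exists M : talent_model R S,
     same_joint_distribution (tm_P M) P (tm_observation M) (fun n => Y n))
  <-> exchangeable P (fun n => Y n).
Proof.
split=> [[M MY]|]; first exact: talent_model_law_exchangeable MY.
exact: exchangeable_talent_model.
Qed.
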